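(* Let $s=s(n)$ satisfy $\log(n)\ll s\leq n$. Then the threshold bias of the rainbow-connectivity game $\mathcal{C}_{s,n}$ satisfies $$\left(\tfrac12-o(1)\right)\frac{sn}{\log(n)}\leq b_{\mathcal{C}_{s,n}}\leq (1+o(1))\frac{sn}{\log(n)}.$$
   Context: $\log$ is the natural logarithm; $f\ll g$ means $f(n)/g(n)\to 0$, and $o(1)$ denotes a quantity tending to $0$ as $n\to\infty$. A $(1:b)$ Maker-Breaker game on a finite board $X$ with a family of winning sets: Maker and Breaker alternately claim unclaimed elements of $X$, Maker $1$ per round and Breaker $b$ per round, until all are claimed; Maker wins if she claims all elements of some winning set, otherwise Breaker wins. The threshold bias is the unique integer $b_0$ such that Breaker wins the $(1:b)$ game iff $b\geq b_0$. For integers $1\leq s\leq n$, the rainbow-connectivity game $\mathcal{C}_{s,n}$ is played on the board $X=\bigcup_{i\in[s]}E(G_i)$, where $G_1,\dots,G_s$ are distinct copies of $K_n$ on the common vertex set $V=[n]$; an edge of $G_i$ has color $i$. Maker wins iff at the end every two vertices of $V$ are joined by a path of Maker's edges whose edges have pairwise distinct colors. *)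

(* Defs.v *)
From mathcomp Require Import all_boot.
From Stdlib Require Import Reals.
Set Implicit Arguments.
Unset Strict Implicit.
Unset Printing Implicit Defensive.

Section MakerBreaker.
Variable X : finType.
(* W M : Maker's final set M contains all elements of some winning set
   (for the rainbow game this is the property "rainbow connected"). *)
Variable W : {set X} -> Prop.

(* [mw b k M F] : Maker (to move) has a strategy to win from the position
   where she owns M and F is the set of unclaimed elements, with fuel k.
   Each round Maker claims one free element, then Breaker claims b free
   elements (or all remaining ones if fewer than b are left).  The game
   ends when everything is claimed, and Maker wins iff W holds for her set. *)
Fixpoint mw (b : nat) (k : nat) (M F : {set X}) : Prop :=
  match k with
  | 0 => W M
  | k'.+1 =>
      if F == set0 then W M
      else exists2 x, x \in F &
        forall Bs : {set X},
          Bs \subset (F :\ x) -> #|Bs| = minn b #|F :\ x| ->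
          mw b k' (x |: M) ((F :\ x) :\: Bs)
  end.

(* Maker wins the (1:b) game (fuel #|X|.+1 suffices: each round claims >= 1). *)
Definition maker_wins (b : nat) : Prop := mw b #|X|.+1 set0 setT.
Definition breaker_wins (b : nat) : Prop := ~ maker_wins b.

Definition is_threshold_bias (b0 : nat) : Prop :=
  forall b : nat, breaker_wins b <-> b0 <= b.
End MakerBreaker.

Definition edgeK (n : nat) := {e : {set 'I_n} | #|e| == 2}.
(* The board: edges of G_1,...,G_s, an edge of G_i coloured i. *)
Definition board (s n : nat) := ('I_s * edgeK n)%type.

Definition edgeIn (s n : nat) (M : {set board s n}) (c : 'I_s) (x y : 'I_n)
  : bool := [exists e in M, (e.1 == c) && (val e.2 == [set x; y])].

Fixpoint mpath (s n : nat) (M : {set board s n}) (x : 'I_n)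
  (st : seq ('I_s * 'I_n)) : bool :=
  match st with
  | [::] => true
  | (c, y) :: st' => edgeIn M c x y && mpath M y st'
  end.

Definition rainbow_connected (s n : nat) (M : {set board s n}) : Prop :=
  forall u v : 'I_n, u != v ->
    exists st : seq ('I_s * 'I_n),
      [/\ mpath M u st, last u (map snd st) = v,
          uniq (map fst st) & uniq (u :: map snd st)].

Definition rainbow_threshold (s n b0 : nat) : Prop :=
  is_threshold_bias (@rainbow_connected s n) b0.

(* Main.v *)
Require Import Defs.
From Stdlib Require Import Reals Lra ZArith Classical.
From mathcomp Require Import all_boot all_order all_algebra zify.
Set Implicit Arguments.
Unset Strict Implicit.
Unset Printing Implicit Defensive.

Local Open Scope nat_scope.

(** Breaker's side.  Breaker isolates a vertex.  He first builds a set of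
    about [n / (4 log n)] vertices that Maker has not touched and inside which
    no edge is free; the stars of these vertices are then disjoint boxes, of
    which Maker spoils at most one per round, and the harmonic sum shows that
    Breaker fills one of them.

    Maker's side.  In a first phase every vertex [v] receives [d] "picks",
    [d] a small multiple of [log n]: Maker edges at [v] of pairwise distinct
    colours.  Serving the vertex that maximises
    [deg_B v - 2 b * (picks of v)] keeps a positive proportion of the edges at
    every unserved vertex free (a box game in which each Breaker edge lies in
    two boxes, whence the constant 1/2).  The free choice of the other endpoint
    is made by the method of conditional expectations, so that the picks
    behave like random ones: no small set [U] sends most of its picks into a
    set of size [D * #|U|].  Because a path of length [L], much smaller than
    [d], forbids only [L] of the [d] distinct colours at its end, every vertex
    reaches linearly many vertices by rainbow paths, even when [L] further
    colours are forbidden.  Growing from [v], and then from [u] avoiding the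
    colours of the path from [v] to [y], shows that a positive proportion of
    the board consists of edges that connect [u] to [v].  Breaker owns only a
    small proportion of the board by then, so Maker connects all pairs greedily
    within [O(log n)] further moves. *)

(** * The Maker-Breaker game *)

Lemma card_setIn_sum (T : finType) (A : {set T}) (r : pred T) :
  #|[set x in A | r x]| = \sum_(x in A) r x.
Proof.
rewrite -sum1_card big_mkcond [RHS]big_mkcond /=; apply: eq_bigr => x _.
by rewrite inE; case: (x \in A); case: (r x).
Qed.

Lemma double_count (T1 T2 : finType) (A : {set T1}) (B : {set T2}) (r : T1 -> T2 -> bool) :
  \sum_(x in A) #|[set y in B | r x y]| = \sum_(y in B) #|[set x in A | r x y]|.
Proof.
under eq_bigr do rewrite card_setIn_sum.
by rewrite exchange_big; apply: eq_bigr => y _; rewrite card_setIn_sum.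
Qed.

Section Game.
Variable (X : finType) (W : {set X} -> Prop).
Hypothesis Wmono : forall M M' : {set X}, M \subset M' -> W M -> W M'.

(** Breaker must claim exactly [minn b #|F|] elements; padding with arbitrary free ones lets a
    strategy prescribe only those that matter. The same extension later enlarges vertex sets to a
    given size. *)
Lemma breaker_reply (Y F : {set X}) (b : nat) :
  Y \subset F -> #|Y| <= b ->
  exists Bs : {set X}, [/\ Y \subset Bs, Bs \subset F & #|Bs| = minn b #|F|].
Proof.
move=> YF Yb; have [m Hm] : exists m, m = minn b #|F| - #|Y| by eexists.
have : minn b #|F| = #|Y| + m by rewrite Hm subnKC // leq_min Yb subset_leq_card.
elim: m Y YF {Yb Hm} => [|m IH] Y YF Hm.
  by exists Y; split => //; rewrite Hm addn0.
have /properP [_ [y yF yY]] : Y \proper F.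
  by rewrite properEcard YF; move: (geq_minr b #|F|); lia.
case: (IH (y |: Y)) => [||Bs [s1 s2 s3]].
- by rewrite subUset sub1set yF YF.
- by rewrite cardsU1 yY; lia.
by exists Bs; split => //; apply: subset_trans s1; apply: subsetUr.
Qed.

Lemma card_after_round (x : X) (F Bs : {set X}) k :
  x \in F -> #|F| < k.+1 -> #|F :\ x :\: Bs| < k.
Proof.
move=> xF; rewrite (cardsD1 x F) xF add1n ltnS; apply: leq_ltn_trans.
exact/subset_leq_card/subsetDl.
Qed.

Lemma mw_of_win b k M F : W M -> mw W b k M F.
Proof.
elim: k M F => [|k IH] M F WM //=.
case: eqP => // /eqP /set0Pn [x xF]; exists x => // Bs _ _.
by apply: IH; apply: Wmono WM; apply: subsetUr.
Qed.

(** Maker never ends with more than [M :|: F], so Breaker has won as soon as that union fails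
    [W]. *)
Lemma mw_win_union b k M F : mw W b k M F -> W (M :|: F).
Proof.
elim: k M F => [|k IH] M F /=; first by apply: Wmono; apply: subsetUl.
case: eqP => [_|_ [x xF H]]; first by apply: Wmono; apply: subsetUl.
have [||Bs [_ s2 s3]] := @breaker_reply set0 (F :\ x) b; rewrite ?sub0set ?cards0 //.
apply: Wmono (IH _ _ (H Bs s2 s3)); apply/subsetP => z; rewrite !inE.
by case: eqP => [->|_] //=; rewrite ?xF ?orbT // => /orP [->|/andP [_ ->]]; rewrite ?orbT.
Qed.

(** Strategy imitation: Maker keeps an imagined game from the worse position and copies its moves
    into the better one. *)
Lemma mw_dominated b b' k k' (M F M' F' : {set X}) :
  b' <= b -> M \subset M' -> M :|: F \subset M' :|: F' -> #|F'| < k' ->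
  mw W b k M F -> mw W b' k' M' F'.
Proof.
move=> bb; elim: k M F M' F' k' => [|k IH] M F M' F' k' MM' MF kF.
  by move=> WM; apply: mw_of_win; apply: Wmono WM.
move=> H0; move: (mw_win_union H0) => WMF; move: H0 => /=; case: eqP => [_ WM|_ [x xF H]].
  by apply: mw_of_win; apply: Wmono WM.
case: k' kF => // k' kF /=.
case: eqP => [F0|/eqP F'0].
  by apply: Wmono WMF; rewrite F0 setU0 in MF.
(* If the imagined move [x] is not free in the actual game, Maker already owns it there, and any
   free [y] will do. *)
have [y [yF' yx]] : exists y, y \in F' /\ (x = y \/ x \in M').
  case: (boolP (x \in F')) => [xF'|xF']; first by exists x; split => //; left.
  case/set0Pn: F'0 => y yF'; exists y; split => //; right.
  by move/subsetP/(_ x): MF; rewrite !inE xF orbT (negbTE xF') orbF => ->.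
exists y => // Bs' sB' cB'.
(* Breaker's actual reply, cut down to the imagined free elements and padded, is a legal imagined
   reply. *)
have [||Bs [t1 t2 t3]] := @breaker_reply (Bs' :&: (F :\ x)) (F :\ x) b.
- exact: subsetIr.
- apply: leq_trans (subset_leq_card (subsetIl _ _)) _.
  by rewrite cB'; apply: leq_trans (geq_minl _ _) bb.
apply: IH (H Bs t2 t3).
- apply/subsetP => z; rewrite !inE => /orP [/eqP -> |zM].
    by case: yx => [->|->]; rewrite ?eqxx ?orbT.
  by rewrite (subsetP MM') ?orbT.
- apply/subsetP => z; rewrite !inE -orbA => /or3P [/eqP ->|zM|/and3P [zB zx zF]].
  + by case: yx => [->|->]; rewrite ?eqxx ?orbT.
  + by rewrite (subsetP MM') ?orbT.
  + have: z \in M' :|: F' by apply: (subsetP MF); rewrite inE zF orbT.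
    rewrite inE => /orP [->|zF']; first by rewrite orbT.
    case: (eqVneq z y) => //= _; rewrite zF' andbT; apply/orP; right.
    by apply: contra zB => zB'; apply: (subsetP t1); rewrite !inE zB' zx zF.
- exact: card_after_round.
Qed.

Lemma breaker_wins_mono b b' : b <= b' -> breaker_wins W b -> breaker_wins W b'.
Proof.
move=> bb nB nB'; apply: nB; apply: mw_dominated nB' => //.
by rewrite cardsT.
Qed.

(** The least bias at which Breaker wins is the threshold, by monotonicity in the bias. *)
Lemma threshold_exists b : breaker_wins W b ->
  exists2 b0, is_threshold_bias W b0 & breaker_wins W b0 /\ b0 <= b.
Proof.
elim/ltn_ind: b => b IH Hb.
case: (classic (exists2 c, c < b & breaker_wins W c)) => [[c cb Hc]|Hn].
  have [b0 H1 [H2 H3]] := IH c cb Hc; exists b0 => //; split => //.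
  exact: leq_trans H3 (ltnW cb).
exists b => // c; split; last by move=> bc; apply: breaker_wins_mono Hb.
by move=> Hc; rewrite leqNgt; apply/negP => cb; apply: Hn; exists c.
Qed.

(* A move claims an element lying in at least the fraction [g / N] of the
   targets [E i] still to be hit. *)
Lemma mw_hitting (I : finType) (P : I -> {set X} -> Prop) (E : I -> {set X})
    (b g t N k : nat) (M F : {set X}) (Q : {set I}) :
  (forall i (M M' : {set X}), M \subset M' -> P i M -> P i M') ->
  (forall M, (forall i, P i M) -> W M) ->
  #|X| <= N -> #|F| < k ->
  (forall i, i \notin Q -> P i M) ->
  (forall i x, i \in Q -> x \in E i -> P i (x |: M)) ->
  (forall i, i \in Q -> g + t * b.+1 <= #|E i :&: F|) ->
  #|Q| * (N - g) ^ t < N ^ t ->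
  mw W b k M F.
Proof.
move=> Pm PW XN; elim: t k M F Q => [|t IH] k M F Q kF HQ HE Hg HN.
  apply: mw_of_win; apply: PW => i; apply: HQ.
  by move: HN; rewrite !expn0 muln1 ltnS leqn0 cards_eq0 => /eqP ->; rewrite inE.
case: (eqVneq Q set0) => [Q0|/set0Pn [i0 i0Q]].
  by apply: mw_of_win; apply: PW => i; apply: HQ; rewrite Q0 inE.
(* Averaging over the free elements: each remaining target has at least [g] of them, so some [x]
   lies in at least the mean number of targets. *)
have [x xF Hx] : exists2 x, x \in F & #|Q| * g <= N * #|[set i in Q | x \in E i]|.
  apply/exists_inP; apply: contraT; rewrite negb_exists_in => /forall_inP Hlt.
  have F0 : F != set0.
    by have := Hg _ i0Q; apply: contraTneq => ->; rewrite setI0 cards0; lia.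
  have S1 : \sum_(x in F) N * #|[set i in Q | x \in E i]| >= N * (#|Q| * g).
    rewrite -big_distrr /= leq_mul2l (double_count F Q (fun x i => x \in E i)).
    rewrite -sum_nat_const; apply/orP; right; apply: leq_sum => i iQ.
    rewrite (_ : [set _ in _ | _] = E i :&: F); last by apply/setP => x; rewrite !inE andbC.
    by apply: leq_trans (Hg i iQ); rewrite leq_addr.
  have S2 : \sum_(x in F) (N * #|[set i in Q | x \in E i]| + 1) <= \sum_(x in F) #|Q| * g.
    by apply: leq_sum => x xF; rewrite addn1 ltnNge; apply: Hlt.
  have S3 : #|F| * (#|Q| * g) <= N * (#|Q| * g).
    by rewrite leq_mul2r (leq_trans (max_card _) XN) orbT.
  rewrite big_split /= !sum_nat_const muln1 in S2.
  by rewrite -card_gt0 in F0; lia.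
case: k kF => // k kF /=; case: eqP => [F0|_]; first by rewrite F0 inE in xF.
exists x => // Bs sB cB.
apply: (IH k _ _ (Q :\: [set i | x \in E i])).
- exact: card_after_round.
- move=> i; rewrite !inE negb_and negbK; case: (boolP (i \in Q)) => iQ /=.
    by rewrite orbF => /(HE _ _ iQ).
  by move=> _; apply: Pm (HQ i iQ); apply: subsetUr.
- move=> i y; rewrite !inE => /andP [_ iQ] yE; apply: Pm (HE i y iQ yE).
  by apply: setUS; apply: subsetUr.
- move=> i; rewrite !inE => /andP [_ iQ].
  (* A round removes at most [b.+1] elements from a target; the reserve [t * b.+1] pays for [t]
     rounds. *)
  have c1 : #|E i :&: F| <= #|E i :&: (F :\ x :\: Bs)| + (1 + #|Bs|).
    rewrite -(cards1 x); apply: leq_trans (leq_add (leqnn _) (leq_card_setU _ _)).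
    apply: leq_trans (leq_card_setU _ _); apply: subset_leq_card.
    apply/subsetP => z; rewrite !inE => /andP [-> ->] /=.
    by case: (z == x); case: (z \in Bs).
  have := Hg i iQ; move: c1; rewrite cB; have := geq_minl b #|F :\ x|; lia.
(* The number of remaining targets shrinks by the factor [(N - g) / N]. Because subtraction is
   truncated, the case [g > N] is separated below. *)
- rewrite !expnS in HN; case: (posnP N) => [N0|N0].
    by move: HN; rewrite N0 [X in _ < X]mul0n ltn0.
  rewrite -(ltn_pmul2l N0); apply: leq_ltn_trans HN.
  rewrite !mulnA leq_mul2r; apply/orP; right.
  move: Hx; rewrite -(cardsID [set i | x \in E i] Q).
  have -> : Q :&: [set i | x \in E i] = [set i in Q | x \in E i].
    by apply/setP => i; rewrite !inE.
  by case: (leqP g N) => gN; nia.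
Qed.
End Game.

(** * Breaker's strategy *)

Section Board.
Variables s n : nat.
Implicit Types (S M F : {set board s n}) (e : board s n) (u v w x y : 'I_n) (c : 'I_s).

Definition star S v := [set e in S | v \in val e.2].
Definition nbr S v := [set cw : 'I_s * 'I_n | edgeIn S cw.1 v cw.2].

Lemma edgeInP S c x y :
  reflect (exists e, [/\ e \in S, e.1 = c & val e.2 = [set x; y]]) (edgeIn S c x y).
Proof.
apply: (iffP exists_inP) => [[e eS /andP [/eqP h1 /eqP h2]]|[e [eS h1 h2]]].
  by exists e.
by exists e => //; apply/andP; split; apply/eqP.
Qed.

Lemma card_edge e : #|val e.2| = 2.
Proof. by apply/eqP; apply: (valP e.2). Qed.

Lemma edgeInC S c x y : edgeIn S c x y = edgeIn S c y x.
Proof. by rewrite /edgeIn setUC. Qed.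

Lemma edgeIn_neq S c x y : edgeIn S c x y -> x != y.
Proof.
case/edgeInP=> e [_ _ He]; have := card_edge e; rewrite He cards2.
by case: (x != y).
Qed.

Lemma edgeIn_mono S S' c x y : S \subset S' -> edgeIn S c x y -> edgeIn S' c x y.
Proof.
by move=> SS /edgeInP [e [eS e1 e2]]; apply/edgeInP; exists e; rewrite (subsetP SS).
Qed.

Lemma edge_other e v : v \in val e.2 -> exists2 w, w != v & val e.2 = [set v; w].
Proof.
move=> ve; have := cardsD1 v (val e.2); rewrite ve card_edge => /eqP.
rewrite eq_sym eqSS => /cards1P [w Hw]; exists w; last by rewrite -(setD1K ve) Hw.
by move/setP/(_ w): Hw; rewrite !inE eqxx => /andP [].
Qed.

Lemma card_nbr S v : #|nbr S v| = #|star S v|.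
Proof.
(* An edge at [v] is determined by its colour and its other endpoint; the default [v] is never
   reached on [star S v]. *)
pose f e := (e.1, odflt v [pick w in val e.2 :\ v]).
have fE e w : w != v -> val e.2 = [set v; w] -> f e = (e.1, w).
  move=> wv Hw; rewrite /f; case: pickP => [z|/(_ w)]; rewrite Hw !inE.
    by case/andP=> zv; rewrite (negbTE zv) => /eqP ->.
  by rewrite wv eqxx orbT.
have inj : {in star S v &, injective f}.
  move=> e e'; rewrite !inE => /andP [_ /edge_other [w wv He]] /andP [_ /edge_other [w' w'v He']].
  rewrite (fE _ _ wv He) (fE _ _ w'v He') => -[E1 E2].
  have E3 : e.2 = e'.2 by apply: val_inj; rewrite He He' E2.
  by rewrite [e]surjective_pairing [e']surjective_pairing E1 E3.
rewrite -(card_in_imset inj); congr #|pred_of_set _|; apply/setP => -[c w]; rewrite !inE /=.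
apply/idP/imsetP => [H|[e]].
  have wv := edgeIn_neq H; case/edgeInP: H => e [eS <- He]; exists e.
    by rewrite inE eS He set21.
  by rewrite (fE _ _ _ He) // eq_sym.
rewrite inE => /andP [eS /edge_other [w' wv He]]; rewrite (fE _ _ wv He) => -[-> ->].
by apply/edgeInP; exists e.
Qed.

Lemma nbr_setT v : nbr setT v = setX setT [set~ v].
Proof.
apply/setP => -[c w]; rewrite !inE /=; apply/idP/idP => [/edgeIn_neq|wv].
  by rewrite eq_sym.
have {}wv : v != w by rewrite eq_sym.
have He : #|[set v; w]| == 2 by rewrite cards2 wv.
by apply/edgeInP; exists (c, exist _ [set v; w] He); split; rewrite ?inE //.
Qed.

Lemma card_star_setT v : #|star setT v| = s * n.-1.
Proof. by rewrite -card_nbr nbr_setT cardsX cardsT card_ord cardsC1 card_ord. Qed.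

Lemma star_mono S S' v : S \subset S' -> star S v \subset star S' v.
Proof. by move=> H; apply/subsetP => e; rewrite !inE => /andP [/(subsetP H) -> ->]. Qed.

Lemma card_star_le S v : #|star S v| <= s * n.
Proof.
apply: leq_trans (subset_leq_card (star_mono v (subsetT S))) _.
by rewrite card_star_setT leq_mul2l leq_pred orbT.
Qed.

Lemma star_sum_in (J : {set 'I_n}) S :
  \sum_(v in J) #|star S v| = \sum_(e in S) #|[set v in J | v \in val e.2]|.
Proof. exact: (double_count J S (fun v e => v \in val e.2)). Qed.

(** An edge lies in at most two stars; this factor 2 is what costs Maker the constant 1/2. *)
Lemma star_sum_le (J : {set 'I_n}) S : \sum_(v in J) #|star S v| <= 2 * #|S|.
Proof.
rewrite star_sum_in mulnC -sum_nat_const; apply: leq_sum => e _.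
apply: leq_trans (_ : #|val e.2| <= 2); last by rewrite card_edge.
by apply: subset_leq_card; apply/subsetP => v; rewrite !inE => /andP [].
Qed.

Lemma card_board_le : #|{: board s n}| <= s * n * n.
Proof.
have := star_sum_in setT setT; under [RHS]eq_bigr => e _.
  rewrite (_ : [set v in setT | _] = val e.2) ?card_edge; last by apply/setP => v; rewrite !inE.
  over.
rewrite sum_nat_const cardsT => H.
apply: leq_trans (_ : #|{: board s n}| * 2 <= _); first by rewrite leq_pmulr.
rewrite -H; apply: leq_trans (_ : \sum_(v in [set: 'I_n]) s * n <= _).
  by apply: leq_sum => v _; apply: card_star_le.
by rewrite sum_nat_const cardsT card_ord mulnC.
Qed.

Lemma mpath_mono S S' x st : S \subset S' -> mpath S x st -> mpath S' x st.
Proof.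
move=> SS; elim: st x => [|[c y] st IH] x //= /andP [H1 H2].
by rewrite (edgeIn_mono SS H1) IH.
Qed.

Lemma rainbow_connected_mono S S' :
  S \subset S' -> rainbow_connected S -> rainbow_connected S'.
Proof.
move=> SS H u v uv; have [st [h1 h2 h3 h4]] := H u v uv.
by exists st; split => //; apply: mpath_mono h1.
Qed.

Lemma isolated_not_rainbow S v : 1 < n -> star S v = set0 -> ~ rainbow_connected S.
Proof.
move=> n1 sv0 H; have [u vu] : exists u, u \in [set~ v].
  by apply/set0Pn; rewrite -card_gt0 cardsC1 card_ord; lia.
rewrite !inE eq_sym in vu; have [[|[c y] st] [h1 h2 _ _]] := H v u vu.
  by rewrite -h2 eqxx in vu.
case/andP: h1 => /edgeInP [e [eS _ He]] _.
have : e \in star S v by rewrite inE eS He set21.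
by rewrite sv0 inE.
Qed.

(** * Isolating a vertex: untouched vertices, the box game, and the preparatory clique *)

Lemma subset_card_ex (T : finType) (A : {set T}) k : k <= #|A| ->
  exists2 A' : {set T}, A' \subset A & #|A'| = k.
Proof.
move=> kA; have [||A' [_ h1 h2]] := @breaker_reply T set0 A k; rewrite ?sub0set ?cards0 //.
by exists A' => //; rewrite h2; apply/minn_idPl.
Qed.

Lemma card_untouched S : n <= #|[set v | star S v == set0]| + 2 * #|S|.
Proof.
apply: leq_trans (_ : #|[set v | star S v == set0]| + #|~: [set v | star S v == set0]| <= _).
  by rewrite cardsC card_ord.
rewrite leq_add2l; apply: leq_trans (star_sum_le (~: [set v | star S v == set0]) S).
by rewrite -sum1_card; apply: leq_sum => v; rewrite !inE card_gt0.
Qed.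

(* With [k] boxes left, each of them loses [b %/ k] free elements per round. *)
Lemma breaker_box b k r K M F (C : {set 'I_n}) :
  1 < n -> #|F| < K -> #|C| = k.+1 ->
  (forall v, v \in C -> star M v = set0) ->
  (forall e, e \in F -> ~~ (val e.2 \subset C)) ->
  (forall v, v \in C -> #|star F v| <= r) ->
  r <= \sum_(1 <= i < k.+1) b %/ i ->
  ~ mw (@rainbow_connected s n) b K M F.
Proof.
move=> n1; elim: k r K M F C => [|k IH] r K M F C KF Ck HM HF Hr Hs Hmw.
  (* One box is left and the empty sum forces [r] to be 0: the vertex has neither Maker edges nor
     free edges. *)
  have [v vC] : exists v, v \in C by apply/set0Pn; rewrite -card_gt0 Ck.
  have := mw_win_union rainbow_connected_mono Hmw; apply: (@isolated_not_rainbow _ v) => //.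
  have := Hr v vC; rewrite big_geq // in Hs; move: Hs; rewrite leqn0 => /eqP ->.
  rewrite leqn0 cards_eq0 => /eqP F0; have M0 := HM v vC.
  apply/setP => e; move/setP/(_ e): F0; move/setP/(_ e): M0; rewrite !inE.
  by case: (v \in _); rewrite ?andbF ?andbT // => -> ->.
case: K KF Hmw => // K KF /=; case: eqP => [F0|_].
  have [v vC] : exists v, v \in C by apply/set0Pn; rewrite -card_gt0 Ck.
  exact: isolated_not_rainbow (HM v vC).
case=> x xF H.
(* No free edge lies inside [C], so Maker's edge meets at most one of the stars. *)
have hC : k.+1 <= #|C :\: val x.2|.
  have : #|val x.2 :&: C| < 2.
    apply: leq_trans (_ : #|val x.2| <= 2); last by rewrite card_edge.
    apply: proper_card; rewrite properE subsetIl /=.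
    by apply: contra (HF x xF) => /subset_trans; apply; apply: subsetIr.
  by have := cardsID (val x.2) C; rewrite setIC Ck; lia.
have {hC} [C' C'C C'k] := subset_card_ex hC.
have [T HT] : exists T : 'I_n -> {set board s n}, forall v, T v \subset star (F :\ x) v /\
     #|T v| = minn (b %/ k.+1) #|star (F :\ x) v|.
  apply: (@fin_all_exists 'I_n (fun=> {set board s n}) (fun v A => A \subset star (F :\ x) v /\
     #|A| = minn (b %/ k.+1) #|star (F :\ x) v|)) => v.
  by have [A h1 h2] := subset_card_ex (geq_minr (b %/ k.+1) #|star (F :\ x) v|); exists A.
have [||Bs [t1 t2 t3]] := @breaker_reply _ (\bigcup_(v in C') T v) (F :\ x) b.
- apply/bigcupsP => v _; apply: subset_trans (proj1 (HT v)) _.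
  by apply/subsetP => e; rewrite inE => /andP [].
- apply: leq_trans (_ : \sum_(v in C') #|T v| <= _).
    elim/big_rec2: _ => [|v A B _]; first by rewrite cards0.
    by move=> h; apply: leq_trans (leq_card_setU _ _) _; rewrite leq_add2l.
  apply: leq_trans (_ : \sum_(v in C') b %/ k.+1 <= _).
    by apply: leq_sum => v _; rewrite (proj2 (HT v)) geq_minl.
  by rewrite sum_nat_const C'k mulnC leq_trunc_div.
apply: (IH (r - b %/ k.+1) _ _ _ C' _ C'k _ _ _ _ (H Bs t2 t3)).
- exact: card_after_round.
- move=> v /(subsetP C'C); rewrite inE => /andP [vx vC].
  apply/setP => e; rewrite !inE; case: eqP => [->|_] /=; first exact: negbTE.
  by have /setP/(_ e) := HM v vC; rewrite !inE.
- move=> e; rewrite !inE => /and3P [_ _ eF]; apply: contra (HF e eF) => /subset_trans; apply.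
  by apply: subset_trans C'C _; apply: subsetDl.
- move=> v vC'; have vC : v \in C by move/(subsetP C'C): vC'; rewrite inE => /andP [].
  have : #|star (F :\ x :\: Bs) v| <= #|star (F :\ x) v :\: T v|.
    apply: subset_leq_card; apply/subsetP => e; rewrite !inE => /andP [/and3P [eB -> ->] ->].
    rewrite !andbT; apply: contra eB => eT; apply: (subsetP t1).
    by apply/bigcupP; exists v.
  have [T1 T2] := HT v; rewrite cardsD (setIidPr T1) T2.
  have h : #|star (F :\ x) v| <= #|star F v| by exact/subset_leq_card/star_mono/subsetDl.
  move: h (Hr v vC); move: (b %/ k.+1) => f. move: #|star F v| #|star (F :\ x) v| #|star (F :\ x :\: Bs) v|. lia.
- by move: Hs; rewrite big_nat_recr //=; lia.
Qed.

(** In each round Maker touches at most one vertex of [C]. Breaker adds one or two untouched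
    vertices, for a net gain of one, and claims the free edges this puts inside the set, at most
    [2 * s * m] of them. After [m] rounds the stars at [C] have no common free edge and the box game
    starts. The bound [#|M| <= #|C|] keeps enough vertices untouched. *)
Lemma breaker_clique b m j K M F (C : {set 'I_n}) :
  1 < n -> 0 < m -> 2 * s * m <= b -> 3 * m <= n -> s * n <= \sum_(1 <= i < m) b %/ i ->
  #|F| < K -> #|C| + j = m -> #|M| <= #|C| ->
  (forall v, v \in C -> star M v = set0) ->
  (forall e, e \in F -> ~~ (val e.2 \subset C)) ->
  ~ mw (@rainbow_connected s n) b K M F.
Proof.
move=> n1 m0 mb mn Hs; elim: j K M F C => [|j IH] K M F C KF Cj MC HM HF Hmw.
  move: Hmw; apply: (@breaker_box b m.-1 (s * n) K M F C) => //; rewrite ?prednK //.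
    by rewrite -Cj addn0.
  by move=> v _; apply: card_star_le.
case: K KF Hmw => // K KF /=; case: eqP => [F0|_].
  have [v Hv] : exists v, v \in [set v | star M v == set0].
    by apply/set0Pn; rewrite -card_gt0; have := card_untouched M; lia.
  by rewrite inE in Hv; apply: isolated_not_rainbow (eqP Hv).
case=> x xF H; pose U := [set v | star (x |: M) v == set0].
have Un : n <= #|U| + 2 * #|M|.+1.
  apply: leq_trans (card_untouched (x |: M)) _; rewrite leq_add2l leq_mul2l /= cardsU1.
  by case: (x \notin M).
have Cx : #|C| <= #|C :\: val x.2| + 1.
  have : #|val x.2 :&: C| < 2.
    apply: leq_trans (_ : #|val x.2| <= 2); last by rewrite card_edge.
    apply: proper_card; rewrite properE subsetIl /=.
    by apply: contra (HF x xF) => /subset_trans; apply; apply: subsetIr.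
  by have := cardsID (val x.2) C; rewrite setIC; lia.
(* Used here as plain set extension inside the untouched vertices; [3 * m <= n] makes the minimum
   equal to [#|C|.+1]. *)
have [||C' [c1 c2 c3]] := @breaker_reply _ (C :\: val x.2) U #|C|.+1.
- apply/subsetP => v; rewrite !inE => /andP [vx vC]; apply/eqP/setP => e; rewrite !inE.
  case: eqP => [->|_] /=; first exact: negbTE.
  by have /setP/(_ e) := HM v vC; rewrite !inE.
- by apply: leq_trans (subset_leq_card (subsetDl _ _)) _.
have {}c3 : #|C'| = #|C|.+1.
  rewrite c3; apply/minn_idPl.
  by move: Un MC Cj mn; move: #|U| #|C| #|M| => ? ? ?; lia.
have [||Bs [t1 t2 t3]] := @breaker_reply _ [set e in F :\ x | val e.2 \subset C'] (F :\ x) b.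
- by apply/subsetP => e; rewrite inE => /andP [].
- set Y := [set _ in _ | _].
  (* Every free edge inside [C'] has an endpoint among the new vertices, since none was inside
     [C]. *)
  apply: leq_trans (_ : \sum_(v in C' :\: (C :\: val x.2)) #|star Y v| <= _).
    rewrite star_sum_in -sum1_card; apply: leq_sum => e; rewrite !inE => /andP [/andP [ex eF] eC'].
    rewrite card_gt0; apply/set0Pn; case/subsetPn: (HF e eF) => v ve vC; exists v.
    by rewrite !inE ve (negbTE vC) andbF (subsetP eC').
  apply: leq_trans (_ : \sum_(v in C' :\: (C :\: val x.2)) s * #|C'| <= _).
    apply: leq_sum => v _; rewrite -card_nbr.
    apply: leq_trans (_ : #|setX [set: 'I_s] C'| <= _); last by rewrite cardsX cardsT card_ord.
    apply: subset_leq_card; apply/subsetP => -[c w]; rewrite !inE /= => /edgeInP [e [eY _ He]].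
    move: eY; rewrite inE => /andP [_ /subsetP]; apply.
    by rewrite He set22.
  rewrite sum_nat_const; apply: leq_trans mb; rewrite -mulnA.
  apply: leq_mul; last by rewrite leq_mul2l c3; lia.
  by rewrite cardsD (setIidPr c1) c3; lia.
apply: (IH _ _ _ C' _ _ _ _ _ (H Bs t2 t3)).
- exact: card_after_round.
- by rewrite c3; lia.
- by rewrite c3 cardsU1; move: MC; case: (x \notin M) => //=; move/leqW.
- by move=> v /(subsetP c2); rewrite inE => /eqP.
- move=> e; rewrite !inE => /and3P [eB ex eF]; apply: contra eB => eC.
  by apply: (subsetP t1); rewrite !inE ex eF.
Qed.

Lemma breaker_wins_isolating b m :
  1 < n -> 0 < m -> 2 * s * m <= b -> 3 * m <= n -> s * n <= \sum_(1 <= i < m) b %/ i ->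
  breaker_wins (@rainbow_connected s n) b.
Proof.
move=> n1 m0 mb mn Hs; apply: (@breaker_clique b m m _ set0 setT set0) => //.
- by rewrite cardsT.
- by rewrite cards0.
- by rewrite cards0.
- by move=> v; rewrite inE.
- by move=> e _; rewrite subset0 -cards_eq0 card_edge.
Qed.
End Board.

(** * Rainbow walks *)

Section RainbowWalks.
Variables s n : nat.
Implicit Types (S M F : {set board s n}) (e : board s n) (u v w x y : 'I_n) (c : 'I_s).

(** Vertices may repeat, so that walks can be concatenated freely; [mpath_simple] restores paths at
    the end. *)
Definition rwalk M u x (st : seq ('I_s * 'I_n)) :=
  [/\ mpath M u st, last u (map snd st) = x & uniq (map fst st)].

Lemma mpath_cat M u st st' :
  mpath M u (st ++ st') = mpath M u st && mpath M (last u (map snd st)) st'.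
Proof. by elim: st u => [|[c y] st IH] u //=; rewrite IH andbA. Qed.

Lemma mpath_rev M u st : mpath M u st ->
  exists st', [/\ mpath M (last u (map snd st)) st',
    last (last u (map snd st)) (map snd st') = u & map fst st' = rev (map fst st)].
Proof.
elim: st u => [|[c y] st IH] u /=; first by exists [::].
case/andP=> H1 /IH [st' [h1 h2 h3]]; exists (rcons st' (c, u)).
rewrite -cats1 mpath_cat h1 h2 /= edgeInC H1 !map_cat last_cat h2 /=; split => //.
by rewrite rev_cons -cats1 h3.
Qed.

(** Cutting out the loop at a repeated vertex only deletes steps, so the colours form a subsequence
    and stay distinct. *)
Lemma mpath_simple M u st : mpath M u st ->
  exists st', [/\ mpath M u st', last u (map snd st') = last u (map snd st),
    subseq (map fst st') (map fst st) & uniq (u :: map snd st')].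
Proof.
elim: st u => [|[c y] st IH] u; first by exists [::].
case/andP=> H1 /IH [st' [h1 h2 h3 h4]].
case: (boolP (u \in y :: map snd st')) => [|uN]; last first.
  exists ((c, y) :: st'); rewrite /= H1 h1 -/(uniq (y :: _)) eqxx; split => //.
  by move: h4 uN => /= -> ->.
rewrite inE => /orP [/eqP uy|].
  exists st'; rewrite uy; split => //=; apply: subseq_trans h3 (subseq_cons _ _).
case/mapP => -[c' w] /= /path.splitPr Hs uw; case: Hs h1 h2 h3 h4 => a b.
rewrite mpath_cat map_cat last_cat /= -uw => /and3P [_ _ h1] h2 h3 h4.
exists b; split => //.
  rewrite map_cat in h3; apply: subseq_trans (subseq_trans h3 (subseq_cons _ _)).
  by apply: subseq_trans (suffix_subseq _ _); apply: subseq_cons.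
by move: h4; rewrite cat_uniq => /andP [_ /and3P [_ _]].
Qed.

Definition rconn u v M := exists st, rwalk M u v st.

Lemma rconn_mono u v M M' : M \subset M' -> rconn u v M -> rconn u v M'.
Proof. by move=> MM [st [h1 h2 h3]]; exists st; split => //; apply: mpath_mono h1. Qed.

Lemma rainbow_connected_rconn M : (forall u v, rconn u v M) -> rainbow_connected M.
Proof.
move=> H u v _; have [st [h1 h2 h3]] := H u v.
have [st' [k1 k2 k3 k4]] := mpath_simple h1.
by exists st'; split => //; rewrite ?k2 //; apply: subseq_uniq k3 h3.
Qed.

Lemma count_mem_uniq_le (T : eqType) (t r : seq T) : uniq r -> count (mem t) r <= size t.
Proof.
move=> ur; rewrite -size_filter; apply: uniq_leq_size; first exact: filter_uniq.
by move=> z; rewrite mem_filter => /andP [].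
Qed.

(** * Growth of the sets reached by rainbow walks *)

Section Growth.
Variables (d d0 D rm L : nat) (p : 'I_n -> seq ('I_s * 'I_n)) (M : {set board s n}).
Hypothesis p_edge : forall v (cw : 'I_s * 'I_n), cw \in p v -> edgeIn M cw.1 v cw.2.
Hypothesis p_uniq : forall v, uniq (map fst (p v)).
Hypothesis p_size : forall v, size (p v) = d.
Hypothesis d0_le : d0 + 2 * L <= d.
Hypothesis D_gt0 : 0 < D.
Hypothesis rm_gt0 : 0 < rm.
Hypothesis Drm : D * rm <= n.
Hypothesis expand : forall U Z : {set 'I_n}, 0 < #|U| -> #|U| <= rm -> #|Z| = D * #|U| ->
  U \subset Z -> ~ (forall x, x \in U -> d0 <= count (fun cw => cw.2 \in Z) (p x)).

(** At a reached vertex, [C] and the walk leading there block at most [2 * L] of the [d] picks,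
    whose colours are distinct. The other picks, at least [d0], lead to reached vertices, so
    expansion multiplies the size by [D] until [D * rm]. *)
Lemma rainbow_growth (C : seq 'I_s) u k : size C <= L -> k <= L ->
  exists R : {set 'I_n}, minn (D ^ k) (D * rm) <= #|R| /\
    forall x, x \in R -> exists st, [/\ rwalk M u x st, size st <= k &
      ~~ has (mem C) (map fst st)].
Proof.
move=> CL; elim: k => [|k IH] kL.
  exists [set u]; rewrite cards1 expn0 geq_minl; split => // x; rewrite inE => /eqP ->.
  by exists [::].
have [R [HR HP]] := IH (ltnW kL).
(* The usable picks depend on the walk, so one walk is fixed for every reached vertex. *)
have [st Hst] : exists st : 'I_n -> seq ('I_s * 'I_n), forall x, x \in R ->
    [/\ rwalk M u x (st x), size (st x) <= k & ~~ has (mem C) (map fst (st x))].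
  apply: (@fin_all_exists 'I_n (fun=> seq ('I_s * 'I_n)) (fun x st => x \in R ->
    [/\ rwalk M u x st, size st <= k & ~~ has (mem C) (map fst st)])) => x.
  by case: (boolP (x \in R)) => [/HP [t Ht]|_]; [exists t|exists [::]].
have [U UR cU] := subset_card_ex (geq_minl #|R| rm).
have U0 : 0 < #|U|.
  by rewrite cU leq_min rm_gt0 andbT; apply: leq_trans HR; rewrite leq_min expn_gt0 D_gt0 muln_gt0 D_gt0.
pose ok x (cw : 'I_s * 'I_n) := cw.1 \notin C ++ map fst (st x) : bool.
pose R' := R :|: [set w | [exists x in U, has (fun cw : 'I_s * 'I_n => (cw.2 == w) && ok x cw) (p x)]].
exists R'; split; last first.
  move=> w; rewrite !inE => /orP [/HP [t [h1 h2 h3]]|].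
    by exists t; split => //; apply: leqW.
  case/exists_inP => x xU /hasP [[c z] cp /= /andP [/eqP zw]].
  rewrite zw {z zw} in cp *; rewrite /ok mem_cat negb_or /= => /andP [cC cst].
  have [[h1 h2 h3] h4 h5] := Hst x (subsetP UR x xU).
  exists (rcons (st x) (c, w)); rewrite size_rcons map_rcons has_rcons negb_or cC h5.
  split => //; split; last by rewrite map_rcons rcons_uniq cst.
    by rewrite -cats1 mpath_cat h1 h2 /= (p_edge cp).
  by rewrite map_rcons last_rcons.
have HU : D * #|U| < #|R'|.
  rewrite ltnNge; apply/negP => R'U.
  (* [expand] speaks of sets of size exactly [D * #|U|], so [R'] is enlarged to one. *)
  have [||Z [z1 _ z3]] := @breaker_reply _ R' setT (D * #|U|) => //.
  have DUn : D * #|U| <= n.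
    by apply: leq_trans Drm; rewrite leq_mul2l cU geq_minr orbT.
  have {}z3 : #|Z| = D * #|U| by rewrite z3 cardsT card_ord; apply/minn_idPl.
  apply: (expand U0 _ z3); rewrite ?cU ?geq_minr //.
    by apply: subset_trans UR (subset_trans _ z1); apply: subsetUl.
  move=> x xU; have [_ sk _] := Hst x (subsetP UR x xU).
  apply: leq_trans (_ : count (ok x) (p x) <= _).
    have := count_predC (fun cw : 'I_s * 'I_n => cw.1 \in C ++ map fst (st x)) (p x).
    rewrite p_size.
    have -> : count (fun cw : 'I_s * 'I_n => cw.1 \in C ++ map fst (st x)) (p x) =
       count (mem (C ++ map fst (st x))) (map fst (p x)) by rewrite count_map.
    have := count_mem_uniq_le (C ++ map fst (st x)) (p_uniq x).
    rewrite size_cat size_map (_ : count (predC _) _ = count (ok x) (p x)) //.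
    move: CL sk d0_le kL; move: (count (ok x) (p x)) (count _ _) (size C) (size (st x)) => ? ? ? ?; lia.
  rewrite (@eq_in_count _ (ok x) (predI (ok x) (fun cw => cw.2 \in Z))).
    by apply: sub_count => cw /andP [].
  move=> [c w] cp /=; case: (boolP (ok x (c, w))) => //= okc; apply/esym.
  apply: (subsetP z1); rewrite !inE.
  by apply/orP; right; apply/exists_inP; exists x => //; apply/hasP; exists (c, w); rewrite //= eqxx.
apply: leq_trans (ltnW HU); rewrite cU expnS.
case: (leqP #|R| rm) => Rrm; last by rewrite geq_minr.
move: HR; rewrite !geq_min !leq_mul2l => /orP [->|h]; first by rewrite orbT.
apply/orP; right; apply/orP; right; apply: leq_trans h.
by rewrite leq_pmull.
Qed.

(** For each [y] reached from [v], growth from [u] avoids the colours of the walk to [y]. An edge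
    from a vertex [x] so reached to [y] closes a rainbow walk unless its colour is among the at most
    [2 * L] used. Counting over ordered pairs sees an edge at most twice. *)
Lemma connecting_edges u v : D * rm <= D ^ L ->
  exists E : {set board s n}, (forall e, e \in E -> rconn u v (e |: M)) /\
    D * rm * (D * rm).-1 * (s - 2 * L) <= 2 * #|E|.
Proof.
move=> DL; set m := D * rm.
have [Rv [HRv HPv]] := @rainbow_growth [::] v L (leq0n L) (leqnn L).
rewrite (minn_idPr DL) -/m in HRv.
have [stv Hstv] : exists st : 'I_n -> seq ('I_s * 'I_n), forall y, y \in Rv ->
    rwalk M v y (st y) /\ size (st y) <= L.
  apply: (@fin_all_exists 'I_n (fun=> seq ('I_s * 'I_n)) (fun y st => y \in Rv ->
    rwalk M v y st /\ size st <= L)) => y.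
  by case: (boolP (y \in Rv)) => [/HPv [t [h1 h2 _]]|_]; [exists t|exists [::]].
have [G HG] : exists G : 'I_n -> {set 'I_n} * ('I_n -> seq ('I_s * 'I_n)),
    forall y, y \in Rv -> m <= #|(G y).1| /\ forall x, x \in (G y).1 ->
      [/\ rwalk M u x ((G y).2 x), size ((G y).2 x) <= L &
          ~~ has (mem (map fst (stv y))) (map fst ((G y).2 x))].
  apply: (@fin_all_exists 'I_n (fun=> ({set 'I_n} * ('I_n -> seq ('I_s * 'I_n)))%type)
    (fun y G => y \in Rv -> m <= #|G.1| /\ forall x, x \in G.1 ->
      [/\ rwalk M u x (G.2 x), size (G.2 x) <= L &
          ~~ has (mem (map fst (stv y))) (map fst (G.2 x))])) => y.
  case: (boolP (y \in Rv)) => [yR|_]; last by exists (set0, fun=> [::]).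
  have [_ sL] := Hstv y yR; rewrite -(size_map fst) in sL.
  have [R [HR HP]] := @rainbow_growth (map fst (stv y)) u L sL (leqnn L).
  rewrite (minn_idPr DL) -/m in HR.
  have [st Hst] : exists st : 'I_n -> seq ('I_s * 'I_n), forall x, x \in R ->
      [/\ rwalk M u x (st x), size (st x) <= L & ~~ has (mem (map fst (stv y))) (map fst (st x))].
    apply: (@fin_all_exists 'I_n (fun=> seq ('I_s * 'I_n)) (fun x st => x \in R ->
      [/\ rwalk M u x st, size st <= L & ~~ has (mem (map fst (stv y))) (map fst st)])) => x.
    by case: (boolP (x \in R)) => [/HP [t Ht]|_]; [exists t|exists [::]].
  by exists (R, st).
pose cols y x := map fst (stv y) ++ map fst ((G y).2 x).
pose E := [set e : board s n | [exists y in Rv, exists x in (G y).1,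
  [&& x != y, e.1 \notin cols y x & val e.2 == [set y; x]]]].
exists E; split.
  move=> e; rewrite inE => /exists_inP [y yR /exists_inP [x xR /and3P [xy ec /eqP He]]].
  have [[a1 a2 a3] a4] := Hstv y yR; have [_ /(_ x xR) [[b1 b2 b3] b4 b5]] := HG y yR.
  have [t [t1 t2 t3]] := mpath_rev a1; rewrite a2 in t1 t2.
  (* From [u] to [x], across [e] to [y], then back along the reversed walk to [v]. *)
  exists ((G y).2 x ++ (e.1, y) :: t); split.
  - rewrite mpath_cat b2 /=; apply/and3P; split.
    + by apply: mpath_mono b1; apply: subsetUr.
    + by apply/edgeInP; exists e; split; rewrite ?setU11 // He setUC.
    + by apply: mpath_mono t1; apply: subsetUr.
  - by rewrite map_cat last_cat /= t2.
  - rewrite map_cat /= t3 cat_uniq b3 /= rev_uniq a3 mem_rev.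
    move: ec; rewrite mem_cat negb_or => /andP [ev eu].
    rewrite ev andbT negb_or eu /= andbT; apply/hasPn => z; rewrite mem_rev => zv.
    by apply: contra b5 => zu; apply/hasP; exists z.
have Hy y : y \in Rv -> m.-1 * (s - 2 * L) <= #|star E y|.
  move=> yR; rewrite -card_nbr; have [_ sv] := Hstv y yR; have [mR HR] := HG y yR.
  apply: leq_trans (_ : \sum_(x in (G y).1 :\ y) #|[set cw in nbr E y | cw.2 == x]| <= _).
    apply: leq_trans (_ : \sum_(x in (G y).1 :\ y) (s - 2 * L) <= _).
      rewrite sum_nat_const leq_mul2r; apply/orP; right.
      rewrite -subn1 leq_subLR; apply: leq_trans mR _.
      by rewrite (cardsD1 y) leq_add2r leq_b1.
    apply: leq_sum => x; rewrite !inE => /andP [xy xR]; have [_ su _] := HR x xR.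
    apply: leq_trans (_ : #|[set c | c \notin cols y x]| <= _).
      have c1 : #|[set c in cols y x]| + #|~: [set c in cols y x]| = s by rewrite cardsC card_ord.
      have c2 : #|[set c in cols y x]| <= 2 * L.
        rewrite cardsE; apply: leq_trans (card_size _) _; rewrite size_cat !size_map mul2n -addnn.
        exact: leq_add.
      have c3 : #|~: [set c in cols y x]| <= #|[set c | c \notin cols y x]|.
        by apply: subset_leq_card; apply/subsetP => c; rewrite !inE.
      by rewrite leq_subLR; apply: leq_trans (leq_add c2 c3); rewrite c1.
    have inj : injective (fun c : 'I_s => (c, x)) by move=> a b [].
    rewrite -(card_imset _ inj); apply: subset_leq_card; apply/subsetP => cw /imsetP [c].
    rewrite !inE => Hc -> /=; rewrite eqxx andbT.
    have He : #|[set y; x]| == 2 by rewrite cards2 (eq_sym y) xy.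
    apply/edgeInP; exists (c, exist _ [set y; x] He); split; rewrite ?inE //.
    apply/exists_inP; exists y => //; apply/exists_inP; exists x => //.
    by rewrite xy Hc /=.
  rewrite (double_count ((G y).1 :\ y) (nbr E y) (fun x cw => cw.2 == x)) -sum1_card.
  apply: leq_sum => cw _; rewrite -(cards1 cw.2); apply: subset_leq_card.
  by apply/subsetP => x; rewrite !inE => /andP [_ /eqP ->].
apply: leq_trans (star_sum_le Rv E).
apply: leq_trans (_ : \sum_(y in Rv) m.-1 * (s - 2 * L) <= _); last exact: leq_sum.
by rewrite sum_nat_const -mulnA leq_mul2r HRv orbT.
Qed.
End Growth.
End RainbowWalks.

(** * Maker's strategy *)

Section Potential.
Variables (s n D rm q : nat).
Import GRing.Theory Num.Theory Order.TTheory.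
Local Open Scope ring_scope.
Implicit Types (p : 'I_n -> seq ('I_s * 'I_n)) (U Z O : {set 'I_n}) (v w x : 'I_n).

Definition hits Z (l : seq ('I_s * 'I_n)) := count (fun cw => cw.2 \in Z) l.
Definition ratio Z : rat := q%:R / #|Z|%:R.
(** A pick at a vertex of [U] contributes the factor [ratio Z / 2] if it hits [Z] and [1 / 2]
    otherwise. *)
Definition weight p U Z : rat := \prod_(x in U) (ratio Z ^+ hits Z (p x) / 2 ^+ size (p x)).
(* [norm_const] is such that the initial potential is at most 1/2, and a pick made
   uniformly among [q] endpoints multiplies each term by at most 1 on average. *)
Definition norm_const Z : rat := (2 * n * 2 ^ #|Z| * 'C(n, #|Z|))%:R^-1.
Definition candidate (UZ : {set 'I_n} * {set 'I_n}) :=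
  [&& (0 < #|UZ.1|)%N, (#|UZ.1| <= rm)%N, #|UZ.2| == (D * #|UZ.1|)%N & UZ.1 \subset UZ.2].
Definition potential p : rat :=
  \sum_(UZ | candidate UZ) norm_const UZ.2 * weight p UZ.1 UZ.2.
Definition add_pick p v cw x := if x == v then cw :: p x else p x.

Lemma norm_const_ge0 Z : 0 <= norm_const Z.
Proof. by rewrite invr_ge0 ler0n. Qed.

Lemma ratio_ge0 Z : 0 <= ratio Z.
Proof. by rewrite divr_ge0 ?ler0n. Qed.

Lemma weight_ge0 p U Z : 0 <= weight p U Z.
Proof. by apply: prodr_ge0 => x _; rewrite divr_ge0 ?exprn_ge0 ?ratio_ge0 ?ler0n. Qed.

(** All weights are 1. There are at most [2 ^ #|Z|] sets [U] inside each [Z], and ['C(n, k)] sets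
    [Z] of size [k], so each of the [n] sizes contributes at most [1 / (2 n)]. *)
Lemma potential_nil : (0 < n)%N -> (0 < D)%N -> potential (fun=> [::]) < 1.
Proof.
move=> n0 D0; suff H : potential (fun=> [::]) <= 2^-1 by apply: le_lt_trans H _.
apply: le_trans (_ : \sum_(Z : {set 'I_n} | (0 < #|Z|)%N) \sum_(U in powerset Z) norm_const Z <= _).
  rewrite (exchange_big_dep predT) //=. rewrite /potential pair_big_dep /=.
  have w1 U Z : weight (fun=> [::]) U Z = 1.
    by rewrite /weight big1 // => x _; rewrite /= !expr0 divr1.
  under eq_bigr => UZ _ do rewrite w1 mulr1.
  rewrite big_mkcond [leRHS]big_mkcond /=; apply: ler_sum => -[U Z] _ /=.
  rewrite powersetE; case: ifP => [/and4P [/= h1 _ /eqP h2 ->]|_].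
    by rewrite h2 muln_gt0 D0 h1.
  by case: ifP => // _; apply: norm_const_ge0.
have cZ Z : (#|Z| < n.+1)%N by rewrite ltnS -[leqRHS]card_ord max_card.
have -> : \sum_(Z : {set 'I_n} | (0 < #|Z|)%N) \sum_(U in powerset Z) norm_const Z =
    \sum_(Z : {set 'I_n} | (0 < #|Z|)%N) ((2 * n)%:R^-1 / 'C(n, #|Z|)%:R).
  apply: eq_bigr => Z _; rewrite sumr_const card_powerset /norm_const -[LHS]mulr_natl.
  have p0 : ((2 ^ #|Z|)%:R : rat) != 0 by rewrite pnatr_eq0 -lt0n expn_gt0.
  by rewrite mulnAC natrM invfM mulrCA divff // mulr1 natrM invfM.
rewrite (partition_big (fun Z : {set 'I_n} => Ordinal (cZ Z)) (fun k => (0 < k)%N)) //=.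
apply: le_trans (_ : \sum_(k < n.+1 | (0 < k)%N) (2 * n)%:R^-1 <= _).
  apply: ler_sum => k k0.
  rewrite (eq_bigr (fun=> (2 * n)%:R^-1 / 'C(n, k)%:R)); last by move=> Z /andP [_ /eqP <-].
  rewrite sumr_const -[leLHS]mulr_natr -mulrA ler_piMr ?invr_ge0 ?ler0n //.
  rewrite mulrC ler_pdivrMr ?ltr0n ?bin_gt0 ?(ltn_ord k) // ?mul1r ?ler_nat; last exact: (ltn_ord k).
  rewrite -[X in 'C(X, _)]card_ord -card_draws; apply: subset_leq_card.
  by apply/subsetP => Z; rewrite !inE => /andP [_ /eqP <-] /=.
rewrite big_mkcond big_ord_recl /= add0r sumr_const card_ord -[leLHS]mulr_natl.
by rewrite natrM invfM mulrCA divff ?mulr1 // pnatr_eq0 -lt0n.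
Qed.

(** A pair violating expansion would by itself contribute a term of at least 1, and all other terms
    are nonnegative. *)
Lemma potential_expand d d0 p : (D * rm <= q)%N -> (0 < D)%N -> (0 < n)%N ->
  (forall r, 0 < r -> r <= rm ->
    2 * n * 2 ^ (D * r) * 'C(n, D * r) * 2 ^ (d * r) * (D * r) ^ (d0 * r) <= q ^ (d0 * r))%N ->
  (forall x, size (p x) = d) -> potential p < 1 ->
  forall U Z, candidate (U, Z) -> ~ (forall x, x \in U -> (d0 <= hits Z (p x))%N).
Proof.
move=> Dq D0 n0 Hr ps P1 U Z UZ HU; move: P1; rewrite ltNge => /negP; apply.
rewrite /potential (bigD1 (U, Z)) //= -[leLHS]addr0; apply: lerD; last first.
  by apply: sumr_ge0 => UZ' _; rewrite mulr_ge0 ?norm_const_ge0 ?weight_ge0.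
case/and4P: UZ => /= U0 Urm /eqP cZ UsZ.
have z0 : (0 < #|Z|)%N by rewrite cZ muln_gt0 D0.
have Zq : (#|Z| <= q)%N by rewrite cZ; apply: leq_trans Dq; rewrite leq_mul2l Urm orbT.
have r1 : 1 <= ratio Z by rewrite /ratio ler_pdivlMr ?ltr0n // mul1r ler_nat.
apply: le_trans (_ : norm_const Z * \prod_(x in U) (ratio Z ^+ d0 / 2 ^+ d) <= _); last first.
  rewrite ler_wpM2l ?norm_const_ge0 //; apply: ler_prod => x xU.
  rewrite divr_ge0 ?exprn_ge0 ?ratio_ge0 ?ler0n //= ps.
  by rewrite ler_wpM2r ?invr_ge0 ?exprn_ge0 ?ler0n // ler_weXn2l // HU.
have Cn : (0 < 'C(n, #|Z|))%N by rewrite bin_gt0 -[leqRHS]card_ord max_card.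
rewrite prodr_const /norm_const mulrC ler_pdivlMr ?mul1r; last first.
  by rewrite ltr0n !muln_gt0 n0 expn_gt0 Cn.
rewrite expr_div_n -!exprM /ratio expr_div_n.
rewrite ler_pdivlMr ?exprn_gt0 ?ltr0n // ler_pdivlMr ?exprn_gt0 ?ltr0n //.
rewrite -!natrX -!natrM ler_nat.
by have := Hr #|U| U0 Urm; rewrite -cZ.
Qed.

(** The mean of the new potential over [w] in [O] is at most the old one, so some [w] does not raise
    it. Hits depend on endpoints only, so the colour may be chosen afterwards. *)
Lemma potential_add_pick p v O : (0 < q)%N -> (q <= #|O|)%N -> (0 < D)%N ->
  exists2 w, w \in O & forall c, potential (add_pick p v (c, w)) <= potential p.
Proof.
move=> q0 qO D0.
pose f (UZ : {set 'I_n} * {set 'I_n}) w : rat :=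
  if v \in UZ.1 then (if w \in UZ.2 then ratio UZ.2 else 1) / 2 else 1.
have fE c w : potential (add_pick p v (c, w)) =
    \sum_(UZ | candidate UZ) norm_const UZ.2 * weight p UZ.1 UZ.2 * f UZ w.
  apply: eq_bigr => -[U Z] _ /=; rewrite -mulrA /f /=; congr (_ * _).
  case: (boolP (v \in U)) => vU; last first.
    rewrite mulr1; apply: eq_bigr => x xU; rewrite /add_pick; case: eqP => // xv.
    by rewrite -xv xU in vU.
  rewrite /weight (bigD1 v vU) [in RHS](bigD1 v vU) /= [RHS]mulrAC; congr (_ * _); last first.
    by apply: eq_bigr => x /andP [_ /negbTE xv]; rewrite /add_pick xv.
  rewrite /add_pick eqxx /hits /= [2 ^+ _.+1]exprS invfM [RHS]mulrACA [_^-1 * 2^-1]mulrC.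
  by congr (_ * _); case: (w \in Z); rewrite /= ?mulr1 // add1n exprSr.
have avg UZ : candidate UZ -> \sum_(w in O) f UZ w <= #|O|%:R.
  case: UZ => U Z /and4P [/= U0 _ /eqP cZ _]; rewrite /f /=.
  case: (v \in U); last by rewrite sumr_const.
  rewrite -mulr_suml ler_pdivrMr // mulr_natr mulr2n.
  apply: le_trans (_ : \sum_(w in O) ((if w \in Z then ratio Z else 0) + 1) <= _).
    by apply: ler_sum => w _; case: (w \in Z); rewrite ?add0r ?lerDl.
  rewrite big_split /= sumr_const lerD2r -big_mkcondr /=.
  rewrite (eq_bigl (fun w => w \in O :&: Z)) => [|w]; last by rewrite inE.
  rewrite sumr_const -[leLHS]mulr_natl /ratio mulrA ler_pdivrMr; last first.
    by rewrite ltr0n cZ muln_gt0 D0.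
  rewrite -!natrM ler_nat mulnC; apply: leq_mul => //.
  by apply: subset_leq_card; apply: subsetIr.
pose g w := \sum_(UZ | candidate UZ) norm_const UZ.2 * weight p UZ.1 UZ.2 * f UZ w.
have Hsum : \sum_(w in O) g w <= \sum_(w in O) potential p.
  rewrite exchange_big /= sumr_const -[leRHS]mulr_natr /potential mulr_suml.
  apply: ler_sum => UZ cUZ; rewrite -mulr_sumr; apply: ler_wpM2l (avg UZ cUZ).
  by rewrite mulr_ge0 ?norm_const_ge0 ?weight_ge0.
have [w wO Hw] : exists2 w, w \in O & g w <= potential p.
  apply/exists_inP; apply: contraT; rewrite negb_exists_in => /forall_inP H.
  have [w0 w0O] : exists w, w \in O by apply/set0Pn; rewrite -card_gt0; apply: leq_trans qO.
  move: Hsum; rewrite leNgt => /negP []; apply: ltr_sum => [|w wO].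
    by apply/hasP; exists w0; rewrite ?mem_index_enum.
  by rewrite ltNge H.
by exists w => // c; rewrite fE.
Qed.
End Potential.

(* Discarding a vertex of maximal danger [dv - Pv] does not increase the average. *)
Lemma danger_average A P k f h dv Pv b2 :
  b2 <= k * f -> A + k * Pv <= k * dv + P -> dv + A <= Pv + P + k.+1 * h ->
  A + b2 <= P + k * (f + h).
Proof.
move=> h1 h2 h3; suff : A <= P + k * h by nia.
by rewrite -(leq_pmul2l (ltn0Sn k)); nia.
Qed.

(** * The two phases of Maker's strategy *)

Section MakerStrategy.
Variables (s n b d d0 D rm L q g t : nat).
Implicit Types (M F : {set board s n}) (e : board s n) (v w x : 'I_n) (J : {set 'I_n})
  (p : 'I_n -> seq ('I_s * 'I_n)).

Definition picks p := \sum_v size (p v).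
Definition breaker_set M F := ~: (M :|: F).
(** A harmonic tail: the term [i] covers the at most [2 * b] that a Breaker move adds to the stars
    of [i] vertices, shared among them and rounded up. *)
Definition danger_bound k := \sum_(k <= i < n) (2 * b %/ i + 1).

(** [inv_danger] bounds the average of [deg_B v - 2 b * (picks of v)] over sets of vertices with
    fewer than [d] picks, written without subtraction. *)
Record maker_inv p M F : Prop := MakerInv {
  inv_edge : forall v (cw : 'I_s * 'I_n), cw \in p v -> edgeIn M cw.1 v cw.2;
  inv_uniq : forall v, uniq (map fst (p v));
  inv_size : forall v, size (p v) <= d;
  inv_maker : #|M| <= picks p;
  inv_breaker : #|breaker_set M F| <= b * picks p;
  inv_danger : forall J, 0 < #|J| -> (forall v, v \in J -> size (p v) < d) ->
    \sum_(v in J) #|star (breaker_set M F) v| <=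
      \sum_(v in J) 2 * b * size (p v) + #|J| * danger_bound #|J|;
  inv_potential : (potential D rm q p < 1)%R }.

Hypothesis n_gt0 : 0 < n.
Hypothesis s_gt0 : 0 < s.
Hypothesis q_gt0 : 0 < q.
Hypothesis D_gt0 : 0 < D.
Hypothesis rm_gt0 : 0 < rm.
Hypothesis Drm_n : D * rm <= n.
Hypothesis Drm_q : D * rm <= q.
Hypothesis d0_le : d0 + 2 * L <= d.
Hypothesis DL : D * rm <= D ^ L.
Hypothesis danger_ok : 2 * b * d + danger_bound 1 + 2 * n * d + s * q <= s * n.-1.
Hypothesis expand_ok : forall r, 0 < r -> r <= rm ->
  2 * n * 2 ^ (D * r) * 'C(n, D * r) * 2 ^ (d * r) * (D * r) ^ (d0 * r) <= q ^ (d0 * r).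
Hypothesis connect_ok :
  2 * (g + t * b.+1 + n * d * b.+1) <= D * rm * (D * rm).-1 * (s - 2 * L).
Hypothesis hit_ok : n * n * (s * n * n - g) ^ t < (s * n * n) ^ t.

(** All picks are made, so expansion holds and every pair has many connecting edges. The first phase
    consumed at most [n * d * b.+1] elements, and [mw_hitting] over all pairs finishes. *)
Lemma maker_endgame p M F K :
  maker_inv p M F -> picks p = n * d -> #|F| < K ->
  mw (@rainbow_connected s n) b K M F.
Proof.
case=> Ie Iu Is Im Ib _ Ip Hp KF.
have ps v : size (p v) = d.
  apply/eqP; rewrite eqn_leq Is /=; rewrite leqNgt; apply/negP => lt_d.
  have : picks p < n * d; last by rewrite Hp ltnn.
  rewrite /picks (bigD1 v) //= -[X in X * d]card_ord -sum_nat_const [ltnRHS](bigD1 v) //=.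
  by rewrite -addSn; apply: leq_add => //; apply: leq_sum.
have Hexp (U Z : {set 'I_n}) : 0 < #|U| -> #|U| <= rm -> #|Z| = D * #|U| -> U \subset Z ->
    ~ (forall x, x \in U -> d0 <= count (fun cw : 'I_s * 'I_n => cw.2 \in Z) (p x)).
  move=> h1 h2 h3 h4; apply: (potential_expand (s := s) (n := n) Drm_q D_gt0 n_gt0 expand_ok ps Ip).
  by rewrite /candidate /= h1 h2 h3 eqxx h4.
have [E HE] : exists E : 'I_n * 'I_n -> {set board s n}, forall uv,
    (forall e, e \in E uv -> rconn uv.1 uv.2 (e |: M)) /\
    D * rm * (D * rm).-1 * (s - 2 * L) <= 2 * #|E uv|.
  apply: (@fin_all_exists _ (fun=> {set board s n}) (fun (uv : 'I_n * 'I_n) E =>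
    (forall e, e \in E -> rconn uv.1 uv.2 (e |: M)) /\
    D * rm * (D * rm).-1 * (s - 2 * L) <= 2 * #|E|)) => uv.
  exact: (connecting_edges Ie Iu ps d0_le D_gt0 rm_gt0 Drm_n Hexp uv.1 uv.2 DL).
apply: (@mw_hitting _ _ (@rainbow_connected_mono s n) _ (fun uv => rconn uv.1 uv.2) E b g t
  (s * n * n) K M F setT) => //.
- by move=> uv; apply: rconn_mono.
- by move=> M' H; apply: rainbow_connected_rconn => u v; apply: (H (u, v)).
- exact: card_board_le.
- by move=> uv; rewrite inE.
- by move=> uv e _; apply: (HE uv).1.
- move=> uv _; have [_ HE2] := HE uv.
  have : #|E uv| <= #|E uv :&: F| + (#|M| + #|breaker_set M F|).
    apply: leq_trans (leq_add (leqnn _) (leq_card_setU _ _)).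
    apply: leq_trans (leq_card_setU _ _); apply: subset_leq_card.
    apply/subsetP => e; rewrite !inE => ->.
    by case: (e \in M); case: (e \in F).
  move: Im Ib HE2 connect_ok; rewrite Hp; move: #|E uv| #|_ :&: _| #|M| #|_| => *; nia.
- by rewrite cardsT card_prod card_ord.
Qed.

Lemma maker_strategy j p M F K :
  maker_inv p M F -> picks p + j = n * d -> #|F| < K ->
  mw (@rainbow_connected s n) b K M F.
Proof.
elim: j p M F K => [|j IH] p M F K Inv Hj KF.
  by apply: maker_endgame Inv _ KF; rewrite -Hj addn0.
have [v0 v0a] : exists v, size (p v) < d.
  apply/existsP; apply: contraT; rewrite negb_exists => /forallP H.
  suff : n * d <= picks p by rewrite -Hj; lia.
  rewrite -[X in X * d]card_ord -sum_nat_const; apply: leq_sum => v _.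
  by rewrite leqNgt.
(* The danger shifted by the constant [2 * b * d], to stay in the naturals. *)
pose key v := #|star (breaker_set M F) v| + 2 * b * (d - size (p v)).
case: (@arg_maxnP _ v0 (fun v => size (p v) < d) key v0a) => v va vmax {v0 v0a}.
have [Ie Iu Is Im Ib Id Ip] := Inv.
pose O := [set w | [exists c, (c \notin map fst (p v)) && edgeIn F c v w]].
(* Not counted towards [O] at [v] are Breaker's edges, at most [n * d] Maker edges, and at most
   [n * d] edges of colours already picked at [v]. At least [s * q] free edges remain, at most [s]
   per endpoint. *)
have qO : q <= #|O|.
  have cT : s * n.-1 <= #|star M v| + (#|star F v| + #|star (breaker_set M F) v|).
    rewrite -(@card_star_setT s n v); apply: leq_trans (leq_add (leqnn _) (leq_card_setU _ _)).
    apply: leq_trans (leq_card_setU _ _); apply: subset_leq_card.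
    by apply/subsetP => e; rewrite !inE andTb => ->; case: (e \in M); case: (e \in F).
  have cM : #|star M v| <= n * d.
    apply: leq_trans (_ : #|M| <= _); last by apply: leq_trans Im _; rewrite -Hj leq_addr.
    by apply: subset_leq_card; apply/subsetP => e; rewrite inE => /andP [].
  have cB : #|star (breaker_set M F) v| <= 2 * b * d + danger_bound 1.
    have := Id [set v]; rewrite !big_set1 cards1 mul1n => /(_ isT) h.
    apply: leq_trans (h _) _; first by move=> x; rewrite inE => /eqP ->.
    by rewrite leq_add2r leq_mul2l Is orbT.
  have cF : #|star F v| <= s * #|O| + n * d.
    rewrite -card_nbr; apply: leq_trans (_ : #|setX [set: 'I_s] O :|:
      setX [set c in map fst (p v)] [set: 'I_n]| <= _).
      apply: subset_leq_card; apply/subsetP => -[c w]; rewrite !inE /= => H.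
      case: (boolP (c \in map fst (p v))) => //= cN; rewrite ?orbT // orbF.
      by apply/existsP; exists c; rewrite cN.
    apply: leq_trans (leq_card_setU _ _) _; rewrite !cardsX !cardsT !card_ord leq_add2l mulnC.
    rewrite leq_mul2l cardsE; apply/orP; right; apply: leq_trans (card_size _) _.
    by rewrite size_map.
  rewrite -(leq_pmul2l s_gt0).
  move: danger_ok cT cM cB cF; rewrite -[2 * n * d]mulnA; move: (s * n.-1) (s * q) (s * #|O|) (n * d) (2 * b * d) => *.
  lia.
have [w wO Hw] := @potential_add_pick s n D rm q p v O q_gt0 qO D_gt0.
have [c cN /edgeInP [e [eF e1 e2]]] : exists2 c, c \notin map fst (p v) & edgeIn F c v w.
  by move: wO; rewrite inE => /existsP [c /andP [h1 h2]]; exists c.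
case: K KF => // K KF /=; case: eqP => [F0|_]; first by rewrite F0 inE in eF.
exists e => // Bs sB cB.
have pS : picks (add_pick p v (c, w)) = (picks p).+1.
  rewrite /picks (bigD1 v) //= [in RHS](bigD1 v) //= /add_pick eqxx /= addSn; congr (_ + _).+1.
  by apply: eq_bigr => x /negbTE ->.
apply: (IH (add_pick p v (c, w))) => //; last 2 first.
- by rewrite pS addSnnS.
- exact: card_after_round.
have Bsub : breaker_set (e |: M) (F :\ e :\: Bs) \subset breaker_set M F :|: Bs.
  apply/subsetP => z; rewrite !inE; case: (z == e) => //=.
  by case: (z \in M); case: (z \in F); case: (z \in Bs).
have cBs : #|Bs| <= b by rewrite cB geq_minl.
have Bstar J : \sum_(x in J) #|star (breaker_set (e |: M) (F :\ e :\: Bs)) x| <=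
    \sum_(x in J) #|star (breaker_set M F) x| + 2 * b.
  apply: (@leq_trans (\sum_(x in J) #|star (breaker_set M F) x| + \sum_(x in J) #|star Bs x|)).
    rewrite -big_split /=; apply: leq_sum => x _.
    apply: leq_trans (leq_card_setU _ _); apply: subset_leq_card.
    apply/subsetP => z; rewrite inE => /andP [/(subsetP Bsub) zB zx].
    by move: zB; rewrite !inE zx !andbT.
  by rewrite leq_add2l; apply: leq_trans (star_sum_le J Bs) _; rewrite leq_mul2l.
split.
- move=> x cw; rewrite /add_pick; case: eqP => [->|_] H; last first.
    by apply: edgeIn_mono (Ie x cw H); apply: subsetUr.
  move: H; rewrite inE => /orP [/eqP ->|H]; last first.
    by apply: edgeIn_mono (Ie v cw H); apply: subsetUr.
  by apply/edgeInP; exists e; rewrite setU11.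
- by move=> x; rewrite /add_pick; case: eqP => //= ->; rewrite cN Iu.
- by move=> x; rewrite /add_pick; case: eqP => //= ->.
- by rewrite pS cardsU1; move: Im; case: (e \notin M) => //= /leqW.
- apply: leq_trans (subset_leq_card Bsub) _; apply: leq_trans (leq_card_setU _ _) _.
  by rewrite pS mulnS addnC leq_add.
- move=> J J0 Ja; apply: leq_trans (Bstar J) _.
  have Ja' x : x \in J -> size (p x) < d.
    by move/Ja; rewrite /add_pick; case: eqP => // ->.
  (* If [v] is in [J], its new pick offsets the [2 * b] added by Breaker. Otherwise the invariant
     for [v |: J] is used: removing the most dangerous vertex does not raise the average, and the
     step from [danger_bound #|J|.+1] to [danger_bound #|J|] absorbs the [2 * b]. *)
  case: (boolP (v \in J)) => vJ.
    have -> : \sum_(x in J) 2 * b * size (add_pick p v (c, w) x) =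
        2 * b + \sum_(x in J) 2 * b * size (p x).
      rewrite (bigD1 v) //= [in RHS](bigD1 v) //= {1}/add_pick eqxx /= mulnS addnA; congr (_ + _).
      by apply: eq_bigr => x /andP [_ /negbTE xv]; rewrite /add_pick xv.
    by rewrite addnC -addnA leq_add2l; apply: Id.
  have [Jv1 Jv2] : 0 < #|v |: J| /\ forall x, x \in v |: J -> size (p x) < d.
    rewrite cardsU1 vJ; split => // x; rewrite !inE => /orP [/eqP ->|] //; apply: Ja'.
  have := Id _ Jv1 Jv2; rewrite !big_setU1 //= cardsU1 vJ add1n.
  have -> : \sum_(x in J) 2 * b * size (add_pick p v (c, w) x) = \sum_(x in J) 2 * b * size (p x).
    by apply: eq_bigr => x xJ; rewrite /add_pick; case: eqP => // xv; rewrite -xv xJ in vJ.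
  have kn : #|J| < n.
    rewrite -[ltnRHS]card_ord -cardsT; apply: proper_card; rewrite properE subsetT /=.
    by apply/subsetPn; exists v.
  have hk : danger_bound #|J| = 2 * b %/ #|J| + 1 + danger_bound #|J|.+1.
    by rewrite /danger_bound big_ltn.
  have dv : 2 * b <= #|J| * (2 * b %/ #|J| + 1).
    by rewrite addn1 [#|J| * _]mulnC; apply/ltnW/ltn_ceil.
  have : \sum_(x in J) (#|star (breaker_set M F) x| + 2 * b * size (p v)) <=
      \sum_(x in J) (#|star (breaker_set M F) v| + 2 * b * size (p x)).
    apply: leq_sum => x xJ; have := vmax x (Ja' x xJ); rewrite /key !mulnBr.
    have := leq_mul (leqnn (2 * b)) (Is v); have := leq_mul (leqnn (2 * b)) (Is x).
    move: (2 * b * size (p v)) (2 * b * size (p x)) (2 * b * d).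
    by move: #|star (breaker_set M F) v| #|star (breaker_set M F) x|; clear; lia.
  rewrite !big_split /= !sum_nat_const hk => h1 h2.
  exact: danger_average dv h1 h2.
- exact: Order.POrderTheory.le_lt_trans (Hw c) Ip.
Qed.

Lemma maker_wins_of_params : maker_wins (@rainbow_connected s n) b.
Proof.
have B0 : breaker_set (set0 : {set board s n}) setT = set0.
  by rewrite /breaker_set set0U setCT.
have p0 : picks (fun=> [::]) = 0 by rewrite /picks big1.
apply: (@maker_strategy (n * d) (fun=> [::])); rewrite ?p0 ?cardsT //.
split => //.
- by rewrite cards0.
- by rewrite B0 cards0.
- move=> J _ _; rewrite B0 big1 // => v _.
  by apply/eqP; rewrite cards_eq0; apply/eqP/setP => e; rewrite !inE.
- exact: potential_nil.
Qed.
End MakerStrategy.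

(** * Asymptotics *)

Lemma bin_le_expn2 n m : 'C(n, m) <= 2 ^ n.
Proof.
elim: n m => [|n IH] [|m]; rewrite ?bin0 ?expn_gt0 //.
by rewrite binS expnS mul2n -addnn leq_add.
Qed.

Lemma expn_le_ffact k m : k ^ m <= (k + m) ^_ m.
Proof.
elim: m => [|m IH]; first by rewrite ffactn0.
by rewrite addnS ffactSS expnS leq_mul // -addnS leq_addr.
Qed.

(** A crude Stirling bound: [z ^ z] is at most the falling factorial of [2 z], which is [z!] times a
    central binomial coefficient. *)
Lemma expn_le_fact z : z ^ z <= 4 ^ z * z`!.
Proof.
apply: leq_trans (expn_le_ffact z z) _; rewrite -bin_ffact leq_mul2r.
by rewrite -[4]/(2 ^ 2) -expnM mul2n -addnn bin_le_expn2 orbT.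
Qed.

Lemma bin_expn_le n z : 'C(n, z) * z ^ z <= 4 ^ z * n ^ z.
Proof.
apply: leq_trans (leq_mul (leqnn _) (expn_le_fact z)) _.
rewrite mulnCA leq_mul2l bin_ffact; apply/orP; right.
elim: z n => [|z IH] n; first by rewrite ffactn0.
rewrite ffactnSr expnSr; apply: leq_mul => //; exact: leq_subr.
Qed.

(** With [z = D * r] and [w = d0 * r], square both sides: [q ^ 2 >= 16 n z] supplies [16 ^ w] for
    the powers of two and one factor [z ^ w]. What remains is [key], where [z / n] is small and [w]
    is large compared to [z]. *)
Lemma expansion_numeric n d d0 D q r :
  0 < D -> 0 < r -> d <= 2 * d0 -> 16 * D <= d0 ->
  16 * n * (D * r) <= q ^ 2 -> 64 * (D * r) <= n ->
  2 * n * 2 ^ (D * r) * 'C(n, D * r) * 2 ^ (d * r) * (D * r) ^ (d0 * r) <= q ^ (d0 * r).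
Proof.
move=> D0 r0 dd0 Dd0; have zw : 16 * (D * r) <= d0 * r by rewrite mulnA leq_mul2r Dd0 orbT.
have dw : d * r <= 2 * (d0 * r) by rewrite mulnA leq_mul2r dd0 orbT.
have z0 : 0 < D * r by rewrite muln_gt0 D0.
move: (D * r) (d0 * r) (d * r) zw dw z0 => z w x zw xw z0 nq zn {D0 r0 dd0 Dd0 D r d d0}.
have nz_z : n * z ^ z <= n ^ z.
  case: z z0 zn {zw nq} => // z _ zn; rewrite [n ^ _]expnS leq_mul2l; apply/orP; right.
  apply: leq_trans (_ : (64 * z.+1) ^ z <= _); last by case: z zn => // z zn; rewrite leq_exp2r.
  by rewrite expnMn expnSr mulnC leq_mul2r (ltn_expl z) ?orbT //.
have key : (2 * n * 2 ^ z * 'C(n, z)) ^ 2 * z ^ w <= n ^ w.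
  (* Six blocks of length [z]: two absorb the squared binomial, one absorbs [64 ^ z], three absorb
     [n ^ 3], which exceeds [4 * n ^ 2]. *)
  have -> : w = z + z + (z + z + z + z + (w - 6 * z)) by lia.
  move: (w - 6 * z) => y.
  have e1 : 64 ^ z * z ^ z <= n ^ z by rewrite -expnMn leq_exp2r.
  have e2 : z ^ y <= n ^ y by case: y => // y; rewrite leq_exp2r //; lia.
  have e3 := bin_expn_le n z.
  have s1 : 64 ^ z = (2 ^ z) ^ 6 by rewrite -[64]/(2 ^ 6) -!expnM mulnC.
  have s2 : 4 ^ z = (2 ^ z) ^ 2 by rewrite -[4]/(2 ^ 2) -!expnM mulnC.
  rewrite s1 in e1; rewrite s2 in e3.
  rewrite !expnD; have n4 : 4 <= n by lia.
  move: (2 ^ z) ('C(n, z)) (z ^ z) (n ^ z) (z ^ y) (n ^ y) e1 e2 e3 nz_z => T C a N Y Y' e1 e2 e3 e4.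
  have f1 : (C * a) * (C * a) <= (T ^ 2 * N) * (T ^ 2 * N) by apply: leq_mul.
  have f2 : (n * a) * (n * a) * (n * a) <= N * N * N by rewrite !leq_mul.
  apply: leq_trans (_ : 4 * n ^ 2 * T ^ 2 * ((T ^ 2 * N) * (T ^ 2 * N)) * (a * a * a * a) * Y <= _).
    apply: leq_trans (_ : 4 * n ^ 2 * T ^ 2 * ((C * a) * (C * a)) * (a * a * a * a) * Y <= _).
      by rewrite !expnS !expn0; lia.
    by do 3![apply: leq_mul => //].
  apply: leq_trans (_ : (n * a * (n * a) * (n * a)) * (T ^ 6 * a) * (N * N) * Y <= _).
    have n23 : 4 * n ^ 2 <= n ^ 3 by rewrite [n ^ 3]expnS leq_mul2r n4 orbT.
    have := leq_mul n23 (leqnn (T ^ 6 * N * N * a * a * a * a * Y)).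
    by rewrite !expnS !expn0; lia.
  apply: leq_trans (_ : (N * N * N) * N * (N * N) * Y' <= _); first by do 4![apply: leq_mul => //].
  by lia.
rewrite -(@leq_exp2r _ _ 2) //; move: (2 * n * 2 ^ z * 'C(n, z)) key => K key.
apply: leq_trans (_ : (K * 2 ^ (2 * w) * z ^ w) ^ 2 <= _).
  by rewrite leq_exp2r // leq_mul2r leq_mul2l leq_exp2l // xw !orbT.
rewrite [leqRHS]expnAC; apply: leq_trans (_ : (16 * n * z) ^ w <= _); last first.
  by case: (w) => // w'; rewrite leq_exp2r.
rewrite !expnMn -!expnM.
have -> : 2 ^ (2 * w * 2) = 16 ^ w by rewrite -[16]/(2 ^ 4) -expnM; congr (2 ^ _); lia.
have -> : z ^ (w * 2) = z ^ w * z ^ w by rewrite -expnD; congr (z ^ _); lia.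
have := leq_mul (leqnn (16 ^ w * z ^ w)) key; move: (K ^ 2) (16 ^ w) (z ^ w) (n ^ w); lia.
Qed.

(** * Real embeddings, logarithms and harmonic sums *)

Local Open Scope R_scope.

Lemma INR_addn m n : INR (m + n)%N = INR m + INR n.
Proof. exact: plus_INR. Qed.

Lemma INR_muln m n : INR (m * n)%N = INR m * INR n.
Proof. exact: mult_INR. Qed.

Lemma INR_expn m n : INR (m ^ n)%N = INR m ^ n.
Proof. by elim: n => [|n IH] //; rewrite expnS INR_muln IH. Qed.

Lemma leq_INR m n : (m <= n)%N -> INR m <= INR n.
Proof. by move/leP/le_INR. Qed.

Lemma INR_leq m n : INR m <= INR n -> (m <= n)%N.
Proof. by move=> H; apply/leP/INR_le. Qed.

Lemma INR_ltn m n : INR m < INR n -> (m < n)%N.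
Proof. by move=> H; apply/ltP/INR_lt. Qed.

Lemma INR_predn n : (0 < n)%N -> INR n.-1 = INR n - 1.
Proof. by case: n => // n _; rewrite S_INR /=; lra. Qed.

Lemma INR_subn_ge m n : INR m - INR n <= INR (m - n)%N.
Proof.
have := leq_INR (_ : m <= n + (m - n))%N; rewrite INR_addn => H.
suff : INR m <= INR n + INR (m - n) by lra.
by apply: H; rewrite -leq_subLR.
Qed.

Lemma nat_floor x : 0 <= x -> exists k, INR k <= x < INR k + 1.
Proof.
move=> x0; have [h1 h2] := base_Int_part x.
have ip : Z.lt (Zneg xH) (Int_part x) by apply: lt_IZR; change (IZR (Zneg xH)) with (-1); lra.
exists (Z.to_nat (Int_part x)); rewrite INR_IZR_INZ Z2Nat.id; first by lra.
by move: ip; lia.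
Qed.

Lemma divn_INR_bounds m k : (0 < k)%N ->
  INR m / INR k - 1 <= INR (m %/ k) <= INR m / INR k.
Proof.
move=> k0; have K0 : 0 < INR k by apply: lt_0_INR; apply/ltP.
have h1 := leq_INR (leq_trunc_div m k); have h2 := leq_INR (ltnW (ltn_ceil m k0)).
move: h1 h2; rewrite !INR_muln S_INR => h1 h2; split.
  by apply: (Rmult_le_reg_r (INR k)) => //; field_simplify; lra.
by apply: (Rmult_le_reg_r (INR k)) => //; field_simplify; lra.
Qed.

Lemma ln_le_sub1 x : 0 < x -> ln x <= x - 1.
Proof.
move=> x0; have := exp_ineq1_le (ln x); rewrite exp_ln //; lra.
Qed.

Lemma ln_monotone x y : 0 < x -> x <= y -> ln x <= ln y.
Proof. by move=> x0 [xy|<-]; [left; apply: ln_increasing|right]. Qed.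

Lemma ln_quotient x y : 0 < x -> 0 < y -> ln (x / y) = ln x - ln y.
Proof.
by move=> x0 y0; rewrite /Rdiv ln_mult ?ln_Rinv //; apply: Rinv_0_lt_compat.
Qed.

Lemma ln_succ_bounds n : (0 < n)%N ->
  / INR n.+1 <= ln (INR n.+1) - ln (INR n) <= / INR n.
Proof.
move=> n0; have N0 : 0 < INR n by apply: lt_0_INR; apply/ltP.
have N1 : 0 < INR n.+1 by rewrite S_INR; lra.
rewrite -ln_quotient //; split; last first.
  apply: Rle_trans (ln_le_sub1 _) _; first exact: Rdiv_lt_0_compat.
  by rewrite S_INR; apply: Req_le; field; lra.
have := @ln_le_sub1 (INR n / INR n.+1); rewrite !ln_quotient // => H.
have : ln (INR n) - ln (INR n.+1) <= INR n / INR n.+1 - 1 by apply: H; apply: Rdiv_lt_0_compat.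
suff -> : INR n / INR n.+1 - 1 = - / INR n.+1 by lra.
by rewrite S_INR; field; lra.
Qed.

(** The harmonic sum dominates the logarithm, and each floor costs at most 1. *)
Lemma box_sum_ge b m : (0 < m)%N ->
  INR b * ln (INR m) - INR m <= INR (\sum_(1 <= i < m) b %/ i).
Proof.
case: m => // m _; elim: m => [|m IH].
  by rewrite big_geq //= ln_1; lra.
have -> : \sum_(1 <= i < m.+2) b %/ i = (\sum_(1 <= i < m.+1) b %/ i + b %/ m.+1)%N.
  by rewrite big_nat_recr.
rewrite INR_addn; have [h1 _] := @divn_INR_bounds b m.+1 isT.
have [_ h2] := @ln_succ_bounds m.+1 isT; have b0 := pos_INR b.
have := Rmult_le_compat_l _ _ _ b0 h2; rewrite /Rdiv in h1; have := S_INR m.+1; lra.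
Qed.

Lemma danger_bound_le n b : (0 < n)%N ->
  INR (danger_bound n b 1) <= 2 * INR b * (1 + ln (INR n)) + INR n.
Proof.
move=> n0; apply: Rle_trans (_ : INR (\sum_(1 <= i < n.+1) (2 * b %/ i + 1)) <= _).
  by apply: leq_INR; rewrite big_nat_recr //= leq_addr.
case: n n0 => // n _; elim: n => [|n IH].
  by rewrite big_nat1 divn1 INR_addn INR_muln /= ln_1; lra.
have -> : \sum_(1 <= i < n.+3) (2 * b %/ i + 1) =
    (\sum_(1 <= i < n.+2) (2 * b %/ i + 1) + (2 * b %/ n.+2 + 1))%N by rewrite big_nat_recr.
rewrite INR_addn INR_addn; have [_ h1] := @divn_INR_bounds (2 * b) n.+2 isT.
have [h2 _] := @ln_succ_bounds n.+1 isT; have b0 := pos_INR b.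
have := Rmult_le_compat_l _ _ _ b0 h2; move: h1 IH; rewrite INR_muln /Rdiv; have := S_INR n.+1.
by change (INR 2) with 2; change (INR 1) with 1; lra.
Qed.

(** From [ln x = 2 ln (sqrt x) <= 2 sqrt x]; the choice of [K] gives [2 <= eps * sqrt x]. *)
Lemma ln_small eps : 0 < eps -> exists K, forall x, K <= x -> ln x <= eps * x.
Proof.
move=> e0; exists (1 + 4 / (eps * eps)) => x Kx.
have k0 : 0 < 4 / (eps * eps) by apply: Rdiv_lt_0_compat; nra.
have x0 : 0 < x by lra.
have s0 := sqrt_lt_R0 _ x0; have ss := sqrt_sqrt x (Rlt_le _ _ x0).
have -> : ln x = 2 * ln (sqrt x) by rewrite -{1}ss ln_mult //; lra.
have := ln_le_sub1 s0 => h.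
have : 4 <= x * (eps * eps).
  have : 4 / (eps * eps) <= x by lra.
  move/(Rmult_le_compat_r (eps * eps)); rewrite /Rdiv Rmult_assoc Rinv_l; nra.
move=> h4; have : 2 <= eps * sqrt x by apply: Rsqr_incr_0_var; rewrite /Rsqr; nra.
nra.
Qed.

Definition for_large (P : nat -> Prop) := exists N, forall n, (N <= n)%N -> P n.

Lemma for_large_and P Q : for_large P -> for_large Q -> for_large (fun n => P n /\ Q n).
Proof.
move=> [N HN] [N' HN']; exists (maxn N N') => n; rewrite geq_max => /andP [h1 h2].
by split; [apply: HN|apply: HN'].
Qed.

Lemma for_large_imp (P Q : nat -> Prop) : (forall n, P n -> Q n) -> for_large P -> for_large Q.
Proof. by move=> PQ [N HN]; exists N => n /HN /PQ. Qed.

Lemma for_large_INR K : for_large (fun n => K <= INR n).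
Proof.
have [k [_ hk]] := nat_floor (Rle_trans _ _ _ (Rabs_pos K) (Rle_refl _)).
exists k.+1 => n /leq_INR; rewrite S_INR => h; have := Rle_abs K; lra.
Qed.

Lemma for_large_ln (P : R -> Prop) :
  (exists K, forall x, K <= x -> P x) -> for_large (fun n => P (ln (INR n))).
Proof.
case=> K HK; apply: for_large_imp (for_large_INR (exp K)) => n h; apply: HK.
by rewrite -[K]ln_exp; apply: ln_monotone h; apply: exp_pos.
Qed.

Lemma for_large_ln_small eps : 0 < eps -> for_large (fun n => ln (INR n) <= eps * INR n).
Proof.
by move/ln_small => [K HK]; apply: for_large_imp (for_large_INR K) => n; apply: HK.
Qed.

(** * Choice of the parameters for both players *)

Lemma INR_subn m n : (n <= m)%N -> INR (m - n)%N = INR m - INR n.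
Proof. by move/leP/minus_INR. Qed.

Lemma exp_pow x k : exp x ^ k = exp (INR k * x).
Proof.
elim: k => [|k IH]; first by rewrite Rmult_0_l exp_0.
by rewrite S_INR /= IH Rmult_plus_distr_r Rmult_1_l exp_plus Rmult_comm.
Qed.

(** The bias is the floor of [(1 + e) y] and the clique size [m] the floor of [n / (4 log n)]. As
    [ln m >= (1 - e / 4) log n], the box sum exceeds [s n] with room for rounding. *)
Lemma breaker_upper_bound s n e :
  0 < e <= 1 -> 4 / e <= ln (INR n) -> ln (INR n) <= INR s -> 8 * ln (INR n) <= INR n ->
  ln (ln (INR n)) + 3 <= e / 4 * ln (INR n) ->
  exists b, INR b <= (1 + e) * (INR s * INR n / ln (INR n)) /\
    breaker_wins (@rainbow_connected s n) b.
Proof.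
move=> [e0 e1] l4 lS lN lnl; set S := INR s in lS *; set N := INR n in l4 lS lN lnl *.
set l := ln N in l4 lS lN lnl *.
have e4 : 4 <= e * l.
  by apply: (Rmult_le_reg_r (/ e)); [exact: Rinv_0_lt_compat|]; field_simplify; lra.
have l1 : 4 <= l by nra.
set y := S * N / l; have yl : y * l = S * N by rewrite /y; field; lra.
set w := N / (4 * l); have wl : w * l * 4 = N by rewrite /w; field; lra.
have w2 : 2 <= w by nra.
have yN : N <= y by nra.
have [b [b1 b2]] := @nat_floor ((1 + e) * y) ltac:(nra).
have [m [m1 m2]] := @nat_floor w ltac:(nra).
exists b; split => //.
have m0 : (0 < m)%N by apply: INR_ltn; change (INR 0) with 0; lra.
(* [m] is at least [w / 2 = N / (8 l)]; the [3] in the hypothesis on [ln l] bounds [ln 8]. *)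
have lnm : (1 - e / 4) * l <= ln (INR m).
  have : ln (w / 2) <= ln (INR m).
    by apply: ln_monotone; lra.
  have -> : w / 2 = N / (8 * l) by rewrite /w; field; lra.
  rewrite ln_quotient; [|lra|lra].
  rewrite ln_mult; [|lra|lra].
  have -> : 8 = 2 * (2 * 2) by lra.
  rewrite !ln_mult; try lra.
  have := @ln_le_sub1 2; rewrite -/l; lra.
apply: (@breaker_wins_isolating s n b m) => //.
- by apply: INR_ltn; change (INR 1) with 1; rewrite -/N; lra.
- apply: INR_leq; rewrite !INR_muln; change (INR 2) with 2; rewrite -/S.
  have Sw : S * w * 4 = y by rewrite /y /w; field; lra.
  have Sm : S * INR m <= S * w by apply: Rmult_le_compat_l; lra.
  have ey : 0 <= e * y by apply: Rmult_le_pos; lra.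
  lra.
- by apply: INR_leq; rewrite INR_muln -/N [INR 3]INR_IZR_INZ /=; nra.
- apply: INR_leq; rewrite INR_muln -/S -/N; apply: Rle_trans (box_sum_ge b m0).
  have h1 : ((1 + e) * y - 1) * ((1 - e / 4) * l) <= INR b * ln (INR m).
    by apply: Rmult_le_compat; nra.
  have h2 : ((1 + e) * y - 1) * ((1 - e / 4) * l) =
    (1 + e) * (1 - e / 4) * (S * N) - (1 - e / 4) * l by rewrite -yl; ring.
  have h3 : (1 + e / 2) * (S * N) <= (1 + e) * (1 - e / 4) * (S * N) by apply: Rmult_le_compat_r; nra.
  have h4 : 4 * N <= e * (S * N) by nra.
  nra.
Qed.

(** [(1 - g / N3) ^ t <= exp (- gam t / 2) < n ^ (-2)]. *)
Lemma hit_numeric (N3 n g t : nat) (gam : R) :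
  0 < gam <= 1 -> (0 < n)%N -> (g <= N3)%N -> (0 < N3)%N ->
  gam / 2 * INR N3 <= INR g -> 4 * ln (INR n) < gam * INR t ->
  (n * n * (N3 - g) ^ t < N3 ^ t)%N.
Proof.
move=> [g0 g1] n0 gN N0 Hg Ht.
have N0' : 0 < INR n by apply: lt_0_INR; apply/ltP.
have N30 : 0 < INR N3 by apply: lt_0_INR; apply/ltP.
apply: INR_ltn; rewrite !INR_muln !INR_expn INR_subn //.
have h1 : (INR N3 - INR g) ^ t <= (INR N3 * exp (- (gam / 2))) ^ t.
  apply: pow_incr; split; first by have := leq_INR gN; lra.
  have := exp_ineq1_le (- (gam / 2)) => h.
  have := Rmult_le_compat_l _ _ _ (Rlt_le _ _ N30) h; lra.
have h2 : INR n * INR n = exp (2 * ln (INR n)).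
  by rewrite (_ : 2 * _ = ln (INR n) + ln (INR n)); [rewrite exp_plus exp_ln|lra].
apply: Rle_lt_trans (_ : INR n * INR n * (INR N3 * exp (- (gam / 2))) ^ t < _).
  by apply: Rmult_le_compat_l => //; nra.
rewrite Rpow_mult_distr exp_pow h2 (Rmult_comm (INR N3 ^ t)) -Rmult_assoc -exp_plus.
rewrite -[X in _ < X]Rmult_1_l; apply: Rmult_lt_compat_r; first exact: pow_lt.
by rewrite -exp_0; apply: exp_increasing; lra.
Qed.

(** Each vertex gets about [kap log n] picks, walks reach about [c n] vertices, and [gam] is the
    density of free connecting edges kept for the second phase. The value of [c] gives
    [16 c = (e / 3) ^ 2], as expansion with [q >= e n / 3] demands; [kap = 2 gam] makes Breaker's
    first-phase edges cost at most about [gam s n ^ 2]. *)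
Lemma maker_lower_bound s n b e (c := e * e / 144) (kap := c * c / 64) (gam := c * c / 128) :
  0 < e <= 1 / 4 ->
  8 / e <= ln (INR n) -> ln (INR n) <= INR s -> 4 * ln (INR n) <= c * INR n ->
  32 * (exp (8 / kap) + 2) <= kap * ln (INR n) -> 640 / (gam * (c * c)) <= INR n ->
  INR b <= (1 / 2 - e) * (INR s * INR n / ln (INR n)) ->
  maker_wins (@rainbow_connected s n) b.
Proof.
move=> [e0 e1]; set S := INR s; set N := INR n; set l := ln N => l8 lS lN lK NK.
have c0 : 0 < c by rewrite /c; nra.
have c1 : c <= / 64 by rewrite /c; nra.
have k0 : 0 < kap by rewrite /kap; nra.
have c2 : c * c <= c * / 64 by apply: Rmult_le_compat_l; lra.
have c3 : c <= e / 500 by rewrite /c; nra.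
have k1 : kap <= e / 16 by rewrite /kap; lra.
have g0 : 0 < gam by rewrite /gam; nra.
have g1 : gam <= 1 by rewrite /gam; lra.
have ckg : kap = 2 * gam by rewrite /kap /gam; lra.
have cg : c * c = 128 * gam by rewrite /gam; lra.
have cE : c = e * e / 144 by [].
clearbody kap gam c.
have el : 8 <= e * l.
  by apply: (Rmult_le_reg_r (/ e)); [exact: Rinv_0_lt_compat|]; field_simplify; lra.
have l1 : 32 <= l by nra.
have NlN : 256 * l <= N by nra.
have eN : 2048 <= e * N by have := Rmult_le_compat_l e _ _ (Rlt_le _ _ e0) NlN; lra.
have cN1 : c * N <= / 64 * N by apply: Rmult_le_compat_r; lra.
have cN2 : c * N <= e / 500 * N by apply: Rmult_le_compat_r; lra.
have gN : 640 <= gam * (c * c) * N.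
  have gc : 0 < gam * (c * c) by nra.
  have := Rmult_le_compat_r _ _ _ (Rlt_le _ _ gc) NK.
  have -> : 640 / (gam * (c * c)) * (gam * (c * c)) = 640 by field; split; lra.
  lra.
set y := S * N / l; have yl : y * l = S * N by rewrite /y; field; lra.
have yN : N <= y by nra.
set X := S * N in yl *; have X0 : 1 <= X by rewrite /X; nra.
have gN1 : 640 <= gam * N.
  have : gam * N * (c * c) <= gam * N * 1 by apply: Rmult_le_compat_l; [apply: Rmult_le_pos|]; lra.
  lra.
have gXN : 640 * X <= gam * (X * N).
  by have := Rmult_le_compat_l X _ _ ltac:(lra) gN1; lra.
have XN0 : 0 < X * N by apply: Rmult_lt_0_compat; lra.
move=> Hb; have b0 := pos_INR b.
have ey : 0 <= e * y by apply: Rmult_le_pos; lra.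
have n0 : (0 < n)%N by apply: INR_ltn; change (INR 0) with 0; rewrite -/N; lra.
have s0 : (0 < s)%N by apply: INR_ltn; change (INR 0) with 0; rewrite -/S; lra.
have [d [d1 d2]] := @nat_floor (kap * l) ltac:(nra).
have [q [q1 q2]] := @nat_floor (e * N / 2) ltac:(nra).
set D := (d %/ 32)%N; set L := (d %/ 4)%N; set K0 := exp (8 / kap) in lK *.
have K1 : 1 < K0 by rewrite -exp_0; apply: exp_increasing; apply: Rdiv_lt_0_compat; lra.
have [D1 D2] := @divn_INR_bounds d 32 isT; rewrite -/D [INR 32]INR_IZR_INZ /= in D1 D2.
have [L1 L2] := @divn_INR_bounds d 4 isT; rewrite -/L [INR 4]INR_IZR_INZ /= in L1 L2.
have DK : K0 <= INR D by lra.
have D0 : (0 < D)%N by apply: INR_ltn; change (INR 0) with 0; lra.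
have kl := Rmult_le_compat_r l _ _ ltac:(lra) k1.
have dp := pos_INR d.
have el1 := Rmult_le_compat_r l _ _ ltac:(lra) e1.
have [rm [r1 r2]] := @nat_floor (c * N / INR D) ltac:(apply: Rlt_le; apply: Rdiv_lt_0_compat; lra).
have m1 : INR D * INR rm <= c * N.
  have := Rmult_le_compat_l (INR D) _ _ ltac:(lra) r1.
  by have -> : INR D * (c * N / INR D) = c * N by field; lra.
have m2 : c * N - INR D < INR D * INR rm.
  have := Rmult_lt_compat_l (INR D) _ _ ltac:(lra) r2.
  have -> : INR D * (c * N / INR D) = c * N by field; lra.
  lra.
have DcN : INR D <= c * N / 4 by lra.
have rm0 : (0 < rm)%N by case: (rm) m2 => // /=; rewrite Rmult_0_r; lra.
have d0L : (d - 2 * L + 2 * L <= d)%N by rewrite subnK // /L; lia.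
have qN : e * N / 3 <= INR q by lra.
(* [D >= exp (8 / kap)] and [L >= kap l / 8] already give [D ^ L >= n]. *)
have DL : (D * rm <= D ^ L)%N.
  apply: INR_leq; rewrite INR_muln INR_expn.
  apply: Rle_trans (_ : K0 ^ L <= _); last by apply: pow_incr; lra.
  rewrite /K0 exp_pow; apply: Rle_trans (_ : N <= _); first by lra.
  have -> : N = exp l by rewrite /l exp_ln //; lra.
  have h : l <= INR L * (8 / kap).
    apply: (Rmult_le_reg_r kap) => //.
    have -> : INR L * (8 / kap) * kap = INR L * 8 by field; lra.
    by lra.
  by case: h => [h|<-]; [left; apply: exp_increasing|right].
have [g [g2 g3]] := @nat_floor (gam * (X * N)) ltac:(lra).
have [t' [t1 t2]] := @nat_floor (4 * l / gam) ltac:(apply: Rlt_le; apply: Rdiv_lt_0_compat; lra).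
have N3E : INR (s * n * n) = X * N by rewrite !INR_muln.
apply: (@maker_wins_of_params s n b d (d - 2 * L) D rm L q g t'.+1) => //.
- by apply: INR_ltn; change (INR 0) with 0; lra.
- by apply: INR_leq; rewrite INR_muln -/N; lra.
- by apply: INR_leq; rewrite INR_muln; lra.
(* The constant 1/2 enters here: the harmonic part [2 b log n] of the danger is at most
   [(1 - 2 e) s n], and the remaining [2 e s n] covers the other terms. *)
- apply: INR_leq; rewrite !INR_addn !INR_muln (INR_predn n0) -/S -/N; change (INR 2) with 2.
  have h1 : INR b * INR d <= y / 2 * (e / 16 * l) by apply: Rmult_le_compat; lra.
  have h2 : INR b * (1 + l) <= (1 / 2 - e) * y * (1 + l) by apply: Rmult_le_compat_r; lra.
  have h3 := danger_bound_le b n0; rewrite -/N -/l in h3.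
  have h4 : y * 8 <= y * (e * l) by apply: Rmult_le_compat_l; lra.
  have h5 : N * (e * l) <= N * (e * S).
    by apply: Rmult_le_compat_l; [lra|apply: Rmult_le_compat_l; lra].
  have h6 : N * 8 <= N * (e * l) by apply: Rmult_le_compat_l; lra.
  have h7 : N * INR d <= N * (e / 16 * l) by apply: Rmult_le_compat_l; lra.
  have h8 : S * INR q <= S * (e * N / 2) by apply: Rmult_le_compat_l; lra.
  have h9 : S * 8 <= S * (e * N) by apply: Rmult_le_compat_l; lra.
  have ye : e * (y * l) = e * X by rewrite yl.
  by move: yl ye; rewrite /X => yl ye; lra.
- move=> r r0 rrm; have rI := leq_INR rrm.
  have Dr : INR D * INR r <= c * N.
    by apply: Rle_trans m1; apply: Rmult_le_compat_l; lra.
  apply: expansion_numeric => //; [by rewrite /L; lia|by rewrite /L /D; lia| |].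
  + apply: INR_leq; rewrite !INR_muln [INR 16]INR_IZR_INZ /= -/N.
    have : (e * N / 3) * (e * N / 3) <= INR q * INR q by apply: Rmult_le_compat; lra.
    have : N * (INR D * INR r) <= N * (c * N) by apply: Rmult_le_compat_l; lra.
    by rewrite cE; lra.
  + by apply: INR_leq; rewrite !INR_muln [INR 64]INR_IZR_INZ /= -/N; lra.
- apply: INR_leq; rewrite !INR_muln.
  have M0 : (0 < D * rm)%N by rewrite muln_gt0 D0.
  rewrite (INR_predn M0) !INR_addn !INR_muln [INR t'.+1]S_INR [INR b.+1]S_INR -/N; change (INR 2) with 2.
  have sL := INR_subn_ge s (2 * L); rewrite INR_muln -/S in sL; change (INR 2) with 2 in sL.
  have h1 : gam * (INR t' + 1) * (INR b + 1) <= (5 * l) * y.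
    have gt : gam * INR t' <= gam * (4 * l / gam) by apply: Rmult_le_compat_l; lra.
    have gE : gam * (4 * l / gam) = 4 * l by field; lra.
    have tp := pos_INR t'; have gtp : 0 <= gam * INR t' by apply: Rmult_le_pos; lra.
    by apply: Rmult_le_compat; lra.
  have h2 : (INR t' + 1) * (INR b + 1) <= gam * (X * N).
    apply: (Rmult_le_reg_l gam) => //.
    have := Rmult_le_compat_l X _ _ ltac:(lra) gN; rewrite cg => h.
    by lra.
  have h3 : INR d * INR b <= (kap * l) * (y / 2).
    by apply: Rmult_le_compat; lra.
  have h4 : N * (INR d * INR b) <= N * ((kap * l) * (y / 2)) by apply: Rmult_le_compat_l; lra.
  have h5 : N * (INR d) <= N * (kap * S).
    apply: Rmult_le_compat_l; first lra.
    by have := Rmult_le_compat_l kap _ _ (Rlt_le _ _ k0) lS; lra.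
  have h6 : kap * X * 2 <= kap * X * N.
    by apply: Rmult_le_compat_l; [apply: Rmult_le_pos|]; lra.
  have h7 : (c * N / 2) * (c * N / 4) <= (INR D * INR rm) * (INR D * INR rm - 1).
    by apply: Rmult_le_compat; lra.
  have h8 : (c * N / 2) * (c * N / 4) * (S / 2) <=
      (INR D * INR rm) * (INR D * INR rm - 1) * INR (s - 2 * L).
    apply: Rmult_le_compat => //; [|lra|lra].
    by apply: Rmult_le_pos; lra.
  have h9 : (c * N / 2) * (c * N / 4) * (S / 2) = 8 * gam * (X * N).
    have -> : (c * N / 2) * (c * N / 4) * (S / 2) = (c * c) * (N * S * N) / 16 by field.
    by rewrite cg /X; field.
  have hA : N * ((kap * l) * (y / 2)) = gam * (X * N) by rewrite -yl ckg; field.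
  rewrite ckg in h5 h6; move: h5 h6; rewrite -/X => h5 h6.
  have hB : N * (2 * gam * S) = 2 * gam * X by rewrite /X; ring.
  by lra.
- apply: (@hit_numeric (s * n * n) n g t'.+1 gam) => //.
  + apply: INR_leq; rewrite N3E.
    have := Rmult_le_compat_r (X * N) _ _ ltac:(lra) g1; lra.
  + by rewrite !muln_gt0 n0 s0.
  + by rewrite N3E; lra.
  + rewrite S_INR -/N -/l.
    have -> : 4 * l = gam * (4 * l / gam) by field; lra.
    by apply: Rmult_lt_compat_l; lra.
Qed.

(** * The two bounds on the threshold bias *)

Open Scope R_scope.
Unset Implicit Arguments.

Theorem theorem1p5 (s : nat -> nat)
  (hs_le : forall n : nat, (s n <= n)%nat)
  (hs_log : forall eps : R, 0 < eps ->
     exists N : nat, forall n : nat, (N <= n)%nat -> ln (INR n) <= eps * INR (s n)) :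
  forall eps : R, 0 < eps ->
  exists N : nat, forall n : nat, (N <= n)%nat ->
    exists b0 : nat, rainbow_threshold (s n) n b0 /\
      (1/2 - eps) * (INR (s n) * INR n / ln (INR n)) <= INR b0 /\
      INR b0 <= (1 + eps) * (INR (s n) * INR n / ln (INR n)).
Proof.
(* The parameter choices need [e <= 1 / 4]; bounds for a smaller [e] imply those for [eps]. *)
move=> eps eps0; pose e := Rmin eps (1 / 4).
have e0 : 0 < e by apply: Rmin_glb_lt; lra.
have e1 : e <= 1 / 4 by apply: Rmin_r.
have ee : e <= eps by apply: Rmin_l.
clearbody e; pose c := e * e / 144.
have c0 : 0 < c by rewrite /c; nra.
have c1 : c <= 1 / 2 by rewrite /c; nra.
have E1 : for_large (fun n => ln (INR n) <= INR (s n)).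
  by apply: for_large_imp (hs_log 1 Rlt_0_1) => n; rewrite Rmult_1_l.
have E2 : for_large (fun n => 8 / e <= ln (INR n)).
  by apply: (for_large_ln (P := fun x => 8 / e <= x)); exists (8 / e).
have E3 := for_large_ln_small (Rdiv_lt_0_compat c 4 c0 ltac:(lra)).
have E4 : for_large (fun n => 32 * (exp (8 / (c * c / 64)) + 2) <= c * c / 64 * ln (INR n)).
  have k0 : 0 < c * c / 64 by nra.
  apply: (for_large_ln (P := fun x => 32 * (exp (8 / (c * c / 64)) + 2) <= c * c / 64 * x)).
  exists (32 * (exp (8 / (c * c / 64)) + 2) / (c * c / 64)) => x.
  move/(Rmult_le_compat_l (c * c / 64) _ _ (Rlt_le _ _ k0)); apply: Rle_trans.
  by right; field; lra.
have E5 := for_large_INR (640 / (c * c / 128 * (c * c))).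
have E6 : for_large (fun n => ln (ln (INR n)) + 3 <= e / 4 * ln (INR n)).
  apply: (for_large_ln (P := fun x => ln x + 3 <= e / 4 * x)).
  have [K HK] := ln_small (Rdiv_lt_0_compat e 8 e0 ltac:(lra)).
  exists (Rmax K (24 / e)) => x Kx; have h1 := HK x (Rle_trans _ _ _ (Rmax_l _ _) Kx).
  have h2 := Rle_trans _ _ _ (Rmax_r _ _) Kx.
  have := Rmult_le_compat_l e _ _ (Rlt_le _ _ e0) h2.
  have -> : e * (24 / e) = 24 by field; lra.
  lra.
have [N HN] := for_large_and E1 (for_large_and E2 (for_large_and E3
  (for_large_and E4 (for_large_and E5 E6)))).
exists N => n /HN [H1 [H2 [H3 [H4 [H5 H6]]]]].
have e8 : 0 < 8 / e by apply: Rdiv_lt_0_compat; lra.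
have l0 : 0 < ln (INR n) by lra.
have n0 := pos_INR n; have cn : c * INR n <= 1 / 2 * INR n by apply: Rmult_le_compat_r; lra.
have y0 : 0 <= INR (s n) * INR n / ln (INR n).
  by apply: Rmult_le_pos; [apply: Rmult_le_pos; apply: pos_INR|apply/Rlt_le/Rinv_0_lt_compat].
have e4 : 4 / e <= ln (INR n) by rewrite (_ : 4 / e = 8 / e / 2); [lra|field; lra].
have [b [b1 b2]] := @breaker_upper_bound (s n) n e ltac:(lra) e4 H1 ltac:(lra) H6.
have [b0 th [w0 /leq_INR b0b]] := threshold_exists (@rainbow_connected_mono (s n) n) b2.
exists b0; split => //; split; last first.
  by have := Rmult_le_compat_r _ _ _ y0 ee; lra.
(* Below the lower bound Maker would win at bias [b0], where Breaker wins. *)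
case: (Rle_or_lt ((1 / 2 - eps) * (INR (s n) * INR n / ln (INR n))) (INR b0)) => // lt_b0.
have ey := Rmult_le_compat_r _ _ _ y0 ee.
by case: w0; apply: (@maker_lower_bound (s n) n b0 e) => //; rewrite -/c; lra.
Qed.
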